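(* Let $K$ be a compact non-empty subset of $\mathbb{R}^d$, let $r>0$, and let $\mathcal{A}=\{A\subset K:\ A\neq\emptyset,\ A\text{ is closed, and }\mathrm{reach}(A)\geq r\}$. Then the class $\partial\mathcal{A}=\{\partial A:\ A\in\mathcal{A}\}$ is a compact subset of $(\mathcal{M},d_H)$. Moreover, $\mathcal{A}$ is a $P$-uniformity class for every Borel probability measure $P$ on $\mathbb{R}^d$ that is absolutely continuous with respect to the Lebesgue measure $\mu$.
   Context: $\partial A$ denotes the topological boundary of $A$; $\mathring{B}(x,\rho)$ is the open Euclidean ball with centre $x$ and radius $\rho$. Reach: let $\mathrm{Unp}(A)$ be the set of points of $\mathbb{R}^d$ having a unique projection (unique nearest point) on $A$. For $x\in A$ let $\mathrm{reach}(A,x)=\sup\{\rho>0:\ \mathring{B}(x,\rho)\subset\mathrm{Unp}(A)\}$, and let $\mathrm{reach}(A)=\inf\{\mathrm{reach}(A,x):\ x\in A\}$. $\mathcal{M}$ is the class of closed, bounded, non-empty subsets of $\mathbb{R}^d$, endowed with the Hausdorff distance $d_H(A,C)=\inf\{\epsilon>0:\ C\subset B(A,\epsilon)\text{ and }A\subset B(C,\epsilon)\}$, where $B(A,\epsilon)=\{x\in\mathbb{R}^d:\ \inf_{y\in A}\|x-y\|\leq\epsilon\}$. $P$-uniformity class: a class $\mathcal{A}$ of Borel subsets of $\mathbb{R}^d$ is a $P$-uniformity class if $\sup_{A\in\mathcal{A}}|P_n(A)-P(A)|\to 0$ for every sequence $P_n$ of Borel probability measures on $\mathbb{R}^d$ that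 converges weakly to $P$ (i.e. $P_n(B)\to P(B)$ for every Borel set $B$ with $P(\partial B)=0$). *)

(* Defs.v *)
From HB Require Import structures.
From mathcomp Require Import all_boot all_order all_algebra.
From mathcomp Require Import all_classical all_reals all_analysis.
From mathcomp Require Import ring.
Import Order.TTheory GRing.Theory Num.Theory.
Import numFieldNormedType.Exports.

Set Implicit Arguments.
Unset Strict Implicit.
Unset Printing Implicit Defensive.

Local Open Scope classical_set_scope.
Local Open Scope ring_scope.

(* The space R^d is 'rV[R]_d.  Its library norm is the sup norm, so the
   Euclidean norm is defined here; both induce the same topology, and open,
   closed, bounded and compact sets are the library's. *)

Section euclidean.
Context {R : realType} {d : nat}.
Implicit Types (x y : 'rV[R]_d) (A : set 'rV[R]_d).

Definition enorm x : R := Num.sqrt (\sum_i x 0 i ^+ 2).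

Definition edist x y : R := enorm (x - y).

Definition edist_set x A : R := inf [set edist x y | y in A].

Definition eball x (rho : R) : set 'rV[R]_d := [set y | edist x y < rho].

Definition thickening A (eps : R) : set 'rV[R]_d :=
  [set x | edist_set x A <= eps].

Definition boundary A : set 'rV[R]_d := closure A `\` A°.

Definition projection A x y := A y /\ forall z, A z -> edist x y <= edist x z.

Definition Unp A : set 'rV[R]_d := [set x | exists! y, projection A x y].

(* The supremum ranges over positive radii, so it is 0 when there is none;
   ereal_sup alone would give -oo. *)
Definition reach_at A x : \bar R :=
  maxe 0%E (ereal_sup [set rho%:E | rho in
    [set rho : R | 0 < rho /\ eball x rho `<=` Unp A]]).

Definition reach A : \bar R := ereal_inf [set reach_at A x | x in A].

Definition hausdorff_dist A C : R :=
  inf [set eps : R | [/\ 0 < eps, C `<=` thickening A eps &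
                         A `<=` thickening C eps]].

Definition reach_class (K : set 'rV[R]_d) (r : R) : set (set 'rV[R]_d) :=
  [set A | [/\ A `<=` K, A !=set0, closed A & (r%:E <= reach A)%E]].

End euclidean.

Section enorm_lemmas.
Context {R : realType} {d : nat}.
Implicit Types (x y z : 'rV[R]_d) (A : set 'rV[R]_d).

Let enorm_sq x : 0 <= \sum_i x 0 i ^+ 2.
Proof. by apply: sumr_ge0 => i _; exact: sqr_ge0. Qed.

Lemma enorm_ge0 x : 0 <= enorm x. Proof. exact: sqrtr_ge0. Qed.

Lemma enormN x : enorm (- x) = enorm x.
Proof.
by rewrite /enorm; congr Num.sqrt; apply: eq_bigr => i _; rewrite mxE sqrrN.
Qed.

Lemma enorm0 : enorm (0 : 'rV[R]_d) = 0.
Proof.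
by rewrite /enorm big1 ?sqrtr0// => i _; rewrite mxE expr0n.
Qed.

Lemma sqr_enorm x : enorm x ^+ 2 = \sum_i x 0 i ^+ 2.
Proof. exact: sqr_sqrtr. Qed.

Lemma coord_le_enorm x i : `|x 0 i| <= enorm x.
Proof.
rewrite -sqrtr_sqr ler_wsqrtr// (bigD1 i)//= lerDl.
by apply: sumr_ge0 => j _; exact: sqr_ge0.
Qed.

Lemma norm_le_enorm x : `|x| <= enorm x.
Proof.
have [/mx_norm_neq0[[i j] /=]|] := boolP (mx_norm x != 0).
  by rewrite -[`|x|]/(mx_norm x) (ord1 i) => ->; exact: coord_le_enorm.
by rewrite negbK -[`|x|]/(mx_norm x) => /eqP ->; exact: enorm_ge0.
Qed.

Lemma enorm_le_norm x : enorm x <= d%:R * `|x|.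
Proof.
apply: (@le_trans _ _ (\sum_(i < d) `|x 0 i|)).
  have s0 : 0 <= \sum_(i < d) `|x 0 i| by exact: sumr_ge0.
  rewrite -(ger0_norm s0) -sqrtr_sqr ler_wsqrtr// expr2 mulr_suml.
  apply: ler_sum => i _; rewrite -real_normK ?num_real// expr2 ler_wpM2l//.
  by rewrite (bigD1 i)//= lerDl sumr_ge0.
rewrite -[in d%:R](card_ord d) -sum1_card natr_sum mulr_suml.
apply: ler_sum => i _; rewrite mul1r -[`|x|]/(mx_norm x) mx_normrE.
by rewrite (le_bigmax _ (fun ij => `|x ij.1 ij.2|) (0, i)).
Qed.

Lemma dot_le_enorm x y : \sum_i x 0 i * y 0 i <= enorm x * enorm y.
Proof.
set a := enorm x; set b := enorm y; set s := \sum_i _.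
have a0 : 0 <= a by exact: enorm_ge0.
have b0 : 0 <= b by exact: enorm_ge0.
have coord0 z i : enorm z = 0 -> z 0 i = 0.
  move=> z0; apply/eqP; rewrite -normr_eq0 eq_le normr_ge0 andbT.
  by rewrite -z0 coord_le_enorm.
have [a_eq0|a_neq0] := eqVneq a 0.
  rewrite a_eq0 mul0r /s big1// => i _.
  by rewrite (coord0 x)// mul0r.
have [b_eq0|b_neq0] := eqVneq b 0.
  rewrite b_eq0 mulr0 /s big1// => i _.
  by rewrite (coord0 y)// mulr0.
have ab0 : 0 < a * b by rewrite mulr_gt0// lt0r ?a_neq0 ?b_neq0.
have : 0 <= \sum_i (b * x 0 i - a * y 0 i) ^+ 2.
  by apply: sumr_ge0 => i _; exact: sqr_ge0.
have -> : \sum_i (b * x 0 i - a * y 0 i) ^+ 2 =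
    b ^+ 2 * (\sum_i x 0 i ^+ 2) + a ^+ 2 * (\sum_i y 0 i ^+ 2) -
    2 * (a * b) * s.
  rewrite !mulr_sumr -big_split/= -sumrB.
  by apply: eq_bigr => i _; ring.
rewrite -!sqr_enorm -/a -/b.
have -> : b ^+ 2 * a ^+ 2 + a ^+ 2 * b ^+ 2 - 2 * (a * b) * s =
    2 * (a * b) * (a * b - s) by ring.
by rewrite pmulr_rge0 ?subr_ge0// mulr_gt0.
Qed.

Lemma enormD x y : enorm (x + y) <= enorm x + enorm y.
Proof.
rewrite -(@ler_pXn2r _ 2%N)// ?nnegrE ?addr_ge0 ?enorm_ge0//.
rewrite sqrrD !sqr_enorm.
have -> : \sum_i (x + y) 0 i ^+ 2 = \sum_i x 0 i ^+ 2 +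
    (\sum_i x 0 i * y 0 i) *+ 2 + \sum_i y 0 i ^+ 2.
  rewrite -sumrMnl -!big_split/=; apply: eq_bigr => i _.
  by rewrite mxE sqrrD.
by rewrite lerD2r lerD2l lerMn2r/= dot_le_enorm.
Qed.

Lemma edist_ge0 x y : 0 <= edist x y. Proof. exact: enorm_ge0. Qed.

Lemma edistxx x : edist x x = 0.
Proof. by rewrite /edist subrr enorm0. Qed.

Lemma edistC x y : edist x y = edist y x.
Proof. by rewrite /edist -enormN opprB. Qed.

Lemma edist_triangle y x z : edist x z <= edist x y + edist y z.
Proof. by rewrite /edist -[x - z](subrKA y) enormD. Qed.

Lemma edist_set_le x y A : A y -> edist_set x A <= edist x y.
Proof.
by move=> Ay; apply: ge_inf; [exists 0 => _ [z _ <-]; exact: edist_ge0|exists y].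
Qed.

Lemma edist_set_adherent x A e delta : A !=set0 -> 0 < delta ->
  edist_set x A <= e -> exists2 y, A y & edist x y < e + delta.
Proof.
move=> [y0 Ay0] delta0 xAe.
have hi : has_inf [set edist x y | y in A].
  split; first by exists (edist x y0), y0.
  by exists 0 => _ [z _ <-]; exact: edist_ge0.
have [_ [y Ay <-] xy] := inf_adherent delta0 hi.
by exists y => //; rewrite (lt_le_trans xy)// lerD2r.
Qed.

Lemma closed_edist_set0 x A : closed A -> A !=set0 ->
  (forall e, 0 < e -> edist_set x A <= e) -> A x.
Proof.
move=> cA A0 xA; apply: cA => B /nbhs_ballP[e /= e0 eB].
have e20 : 0 < e / 2 by rewrite divr_gt0.
have [y Ay xy] := edist_set_adherent A0 e20 (xA _ e20).
exists y; split=> //; apply: eB; rewrite -ball_normE/=.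
by rewrite (le_lt_trans (norm_le_enorm _))// [e]splitr.
Qed.

End enorm_lemmas.

Section hyperspace.
Context (R : realType) (d : nat).

Record hyperspace := Hyperspace {
  hset : set 'rV[R]_d ;
  hset_closed : closed hset ;
  hset_bounded : bounded_set hset ;
  hset_nonempty : hset !=set0 }.

Implicit Types A B C : hyperspace.

HB.instance Definition _ := gen_eqMixin hyperspace.
HB.instance Definition _ := gen_choiceMixin hyperspace.

Lemma hset_inj A C : hset A = hset C -> A = C.
Proof.
case: A C => [A cA bA A0] [C cC bC C0] /= AC; subst C.
by congr Hyperspace; exact: Prop_irrelevance.
Qed.

Let eps_set A C : set R := [set eps : R |
  [/\ 0 < eps, hset C `<=` thickening (hset A) eps &
      hset A `<=` thickening (hset C) eps]].

Let eps_set_has_inf A C : has_inf (eps_set A C).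
Proof.
split; last by exists 0 => e [/ltW].
have [M [Mreal AM]] := hset_bounded A.
have [N [Nreal CN]] := hset_bounded C.
pose L : R := Num.max `|M| `|N| + 1.
have AL x : hset A x -> `|x| <= L.
  move=> Ax; apply: (AM L) => //.
  by rewrite (le_lt_trans (ler_norm _))// ltr_pwDr// le_max lexx.
have CL x : hset C x -> `|x| <= L.
  move=> Cx; apply: (CN L) => //.
  by rewrite (le_lt_trans (ler_norm _))// ltr_pwDr// le_max lexx orbT.
have dist_le (x y : 'rV[R]_d) : `|x| <= L -> `|y| <= L -> edist x y <= d%:R * (L + L) + 1.
  move=> xL yL; rewrite (le_trans (enorm_le_norm _))//.
  rewrite -[leLHS]addr0 lerD// ler_wpM2l//.
  by rewrite (le_trans (ler_normB _ _))// lerD.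
have [a Aa] := hset_nonempty A; have [c Cc] := hset_nonempty C.
exists (d%:R * (L + L) + 1); split.
- rewrite ltr_pwDr// mulr_ge0// -mulr2n mulrn_wge0//.
  by rewrite addr_ge0// le_max normr_ge0.
- move=> x Cx; rewrite /thickening/= (le_trans (edist_set_le _ Aa))//.
  by apply: dist_le; [exact: CL|exact: AL].
- move=> x Ax; rewrite /thickening/= (le_trans (edist_set_le _ Cc))//.
  by apply: dist_le; [exact: AL|exact: CL].
Qed.

Let hdist A C : R := hausdorff_dist (hset A) (hset C).

Let hdistxx A : hdist A A = 0.
Proof.
apply/eqP; rewrite eq_le; apply/andP; split; last first.
  by apply: lb_le_inf => [|e [/ltW]//]; exact: (eps_set_has_inf A A).1.
apply/ler_addgt0Pl => e e0; rewrite addr0.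
have sub : hset A `<=` thickening (hset A) e.
  move=> x Ax; rewrite /thickening/= (le_trans (edist_set_le x Ax))//.
  by rewrite edistxx ltW.
by apply: ge_inf; [exact: (eps_set_has_inf A A).2|split].
Qed.

Let hdistC A C : hdist A C = hdist C A.
Proof.
by congr inf; apply/seteqP; split=> e [].
Qed.

Let hdist_positivity A C : hdist A C = 0 -> A = C.
Proof.
move=> AC0; apply: hset_inj.
have le_e e : 0 < e -> exists2 e', eps_set A C e' & e' < e.
  move=> e0; have [e' e'AC] := inf_adherent e0 (eps_set_has_inf A C).
  by rewrite -/(hausdorff_dist (hset A) (hset C)) -/(hdist A C) AC0 add0r; exists e'.
apply/seteqP; split=> x Xx.
- apply: (closed_edist_set0 (hset_closed (h:=C)) (hset_nonempty C)) => e e0.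
  have [e' [_ _ AC] /ltW] := le_e _ e0.
  by apply: le_trans; exact: AC.
- apply: (closed_edist_set0 (hset_closed (h:=A)) (hset_nonempty A)) => e e0.
  have [e' [_ CA _] /ltW] := le_e _ e0.
  by apply: le_trans; exact: CA.
Qed.

Let thickening_trans A B C e1 e2 :
  hset B `<=` thickening (hset A) e1 -> hset C `<=` thickening (hset B) e2 ->
  hset C `<=` thickening (hset A) (e1 + e2).
Proof.
move=> BA CB x Cx; rewrite /thickening/=; apply/ler_addgt0Pr => e e0.
have e20 : 0 < e / 2 by rewrite divr_gt0.
have [y By xy] := edist_set_adherent (hset_nonempty B) e20 (CB _ Cx).
have [z Az yz] := edist_set_adherent (hset_nonempty A) e20 (BA _ By).
rewrite (le_trans (edist_set_le x Az))// (le_trans (edist_triangle y _ _))//.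
rewrite (le_trans (lerD (ltW xy) (ltW yz)))//.
by rewrite addrACA -splitr (addrC e2).
Qed.

Let hdist_triangle B A C : hdist A C <= hdist A B + hdist B C.
Proof.
apply/ler_addgt0Pr => e e0.
have e20 : 0 < e / 2 by rewrite divr_gt0.
have [e1 [e10 BA AB] e1lt] := inf_adherent e20 (eps_set_has_inf A B).
have [e2 [e20' CB BC] e2lt] := inf_adherent e20 (eps_set_has_inf B C).
apply: (@le_trans _ _ (e1 + e2)).
  apply: ge_inf; first exact: (eps_set_has_inf A C).2.
  split; [exact: addr_gt0|exact: thickening_trans BA CB|].
  by rewrite addrC; exact: thickening_trans BC AB.
by rewrite (le_trans (lerD (ltW e1lt) (ltW e2lt)))// addrACA -splitr.
Qed.

HB.instance Definition _ := isMetric.Build R hyperspace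
  hdistxx hdist_positivity hdistC hdist_triangle.

Lemma mdist_hyperspaceE A C : mdist A C = hausdorff_dist (hset A) (hset C).
Proof. by []. Qed.

End hyperspace.

Notation borel R d := (g_sigma_algebraType (@open 'rV[R]_d)).

Section measures.
Context (R : realType) (d : nat).

Definition box (a b : 'rV[R]_d) : set 'rV[R]_d :=
  [set x | forall i, a 0 i <= x 0 i <= b 0 i].

Definition box_volume (a b : 'rV[R]_d) : R := \prod_i (b 0 i - a 0 i).

(* Lebesgue outer measure; its restriction to the Borel sets is the Lebesgue
   measure. *)
Definition lebesgue (A : set (borel R d)) : \bar R :=
  ereal_inf [set (\sum_(k <oo) (box_volume (a k).1 (a k).2)%:E)%E |
    a in [set a : nat -> 'rV[R]_d * 'rV[R]_d |
      (forall k i, (a k).1 0 i <= (a k).2 0 i) /\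
      A `<=` \bigcup_k box (a k).1 (a k).2]].

Definition weakly_converges (P_ : nat -> probability (borel R d) R)
    (P : probability (borel R d) R) :=
  forall B : set (borel R d), measurable B -> P (boundary B) = 0%E ->
    P_ n B @[n --> \oo] --> P B.

(* The supremum is taken in R: the differences are at most 1, and the supremum
   over the empty class is 0. *)
Definition uniformity_class (F : set (set 'rV[R]_d)) (P : probability (borel R d) R) :=
  (F `<=` (measurable : set (set (borel R d)))) /\
  forall P_ : nat -> probability (borel R d) R, weakly_converges P_ P ->
    sup [set `|fine (P_ n A) - fine (P A)| | A in F] @[n --> \oo] --> (0 : R).

End measures.

(* Main.v *)
Require Import Defs.
From mathcomp Require Import all_boot all_order all_algebra.
From mathcomp Require Import all_classical all_reals all_analysis.
From mathcomp Require Import ring lra.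
Import Order.TTheory GRing.Theory Num.Theory.
Import numFieldNormedType.Exports.
(* Restores the Euclidean [edist], hidden by the extended distance of the
   same name. *)
Import Defs.
Local Open Scope classical_set_scope.
Local Open Scope ring_scope.

(** Why the theorem is true.

The condition reach(A) >= r, on a compact set A, is equivalent to an
inequality between distances, [prox_regular]: every y at distance less than r
from A has a point p of A such that no point of A lies in the open ball of
radius r that touches A at p and has its centre on the ray from p through y.
Once y has such a p, strict inequality in the law of cosines makes p the only
nearest point, so this condition gives the reach back
([prox_regular_reach]). The converse is a theorem of Federer
([edist_set_normal_ray]): p remains nearest to p + t u for all t < r, where u
is the direction of y - p. Federer follows the gradient flow of the distance
to A; here a maximum argument replaces the flow. If the distance did not grow
at unit speed from c, then distance(z) - k |z - c| would, for some k < 1, have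
a maximum in the interior of a small ball around c; but at a point with one
nearest point q the distance grows with slope 1 in the direction away from q
([slope_edist_set]).

Two consequences of [prox_regular] carry the rest. It passes to limits of
sets, being a weak inequality between continuous functions. And it yields
holes ([boundary_hole]): within about t of a boundary point, for any t < r,
there is a centre of a ball of radius t that misses A.

Compactness. Sets of the class indexed by an ultrafilter have a limit L, the
set of the points that they approach. Since K is compact the approach is
uniform, so L is a Hausdorff limit, and L is again in the class. The
boundaries converge too. If the boundaries of the sets stayed away from a
boundary point x of L, the sets, which come close to x, would fill a fixed
ball around x, and so would L. If boundary points of the sets accumulated at
an interior point of L, the holes next to them, whose radius does not shrink,
would lie in L, which the sets approach everywhere.

Uniformity. The holes make the boundary of a set A of the class porous: of the
N^d equal subcubes of a small cube at least one misses the boundary, with a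
fixed N. Iterating covers the boundary by cubes of total volume at most a
constant times ((N^d - 1) / N^d)^k for all k, so it is Lebesgue null, hence
P-null. Suppose now that |P_n(A_n) - P(A_n)| > e for infinitely many n, and
let L be the limit of these A_n along an ultrafilter. Both A_n and its
boundary converge, so A_n and L differ only inside a thickening T of the
boundary of L, where P(T) is small and the boundary of T is P-null for a
suitable thickness. Weak convergence then controls P_n(T) and P_n(L), which
contradicts the choice of the A_n. *)

(** * Euclidean norm, distance, and distance to a set *)

Section euclidean_geometry.
Context {R : realType} {d : nat}.
Implicit Types (x y z p q : 'rV[R]_d) (e : R) (A : set 'rV[R]_d).

Definition dot x y : R := \sum_i x 0 i * y 0 i.

Lemma dotC x y : dot x y = dot y x.
Proof. by apply: eq_bigr => i _; rewrite mulrC. Qed.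

Lemma dotDl x y z : dot (x + y) z = dot x z + dot y z.
Proof. by rewrite -big_split; apply: eq_bigr => i _; rewrite mxE mulrDl. Qed.

Lemma dotZl (k : R) x y : dot (k *: x) y = k * dot x y.
Proof. by rewrite mulr_sumr; apply: eq_bigr => i _; rewrite mxE mulrA. Qed.

Lemma dotNl x y : dot (- x) y = - dot x y.
Proof. by rewrite -scaleN1r dotZl mulN1r. Qed.

Lemma sqr_enorm_dot x : enorm x ^+ 2 = dot x x.
Proof. by rewrite sqr_enorm; apply: eq_bigr => i _; rewrite expr2. Qed.

Lemma sqr_enormD x y :
  enorm (x + y) ^+ 2 = enorm x ^+ 2 + 2 * dot x y + enorm y ^+ 2.
Proof.
rewrite !sqr_enorm_dot dotDl !(dotC _ (x + y)) !dotDl (dotC y x); ring.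
Qed.

Lemma enormZ (k : R) x : enorm (k *: x) = `|k| * enorm x.
Proof.
apply/eqP; rewrite -(@eqrXn2 _ 2)// ?mulr_ge0 ?enorm_ge0//.
by rewrite exprMn !sqr_enorm_dot dotZl dotC dotZl mulrA -expr2 real_normK ?num_real.
Qed.

Lemma enorm_eq0 x : (enorm x == 0) = (x == 0).
Proof.
apply/eqP/eqP => [x0|->]; last exact: enorm0.
by apply/eqP; rewrite -normr_le0 -x0 norm_le_enorm.
Qed.

Lemma edist_eq0 x y : (edist x y == 0) = (x == y).
Proof. by rewrite enorm_eq0 subr_eq0. Qed.

Lemma edist_gt0 x y : (0 < edist x y) = (x != y).
Proof. by rewrite lt_def edist_ge0 edist_eq0 andbT. Qed.

Lemma edist_addl x y : edist (x + y) x = enorm y.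
Proof. by rewrite /edist addrAC subrr add0r. Qed.

Lemma nbhs_eball x (B : set 'rV[R]_d) :
  nbhs x B <-> exists2 e, 0 < e & eball x e `<=` B.
Proof.
split=> [/nbhs_ballP[e /= e0 eB]|[e e0 eB]].
  exists e => // y xy; apply: eB; rewrite -ball_normE/=.
  exact: le_lt_trans (norm_le_enorm _) xy.
apply/nbhs_ballP; exists (e / (d%:R + 1)) => /=.
  by rewrite divr_gt0// ltr_wpDl.
move=> y; rewrite -ball_normE/= => xy; apply: eB.
rewrite /eball/= (le_lt_trans (enorm_le_norm _))//.
rewrite (@le_lt_trans _ _ ((d%:R + 1) * `|x - y|))//.
  by rewrite ler_wpM2r// lerDl.
by rewrite mulrC -ltr_pdivlMr// ltr_wpDl.
Qed.

Lemma eball_nbhs x e : 0 < e -> nbhs x (eball x e).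
Proof. by move=> e0; apply/nbhs_eball; exists e. Qed.

Lemma open_eball x e : open (eball x e).
Proof.
rewrite openE => y xy; apply/nbhs_eball.
exists (e - edist x y); first by rewrite subr_gt0.
move=> z yz; rewrite /eball/= (le_lt_trans (edist_triangle y _ _))//.
by rewrite addrC -ltrBrDr.
Qed.

Lemma compact_closed_rV A : compact A -> closed A.
Proof. by apply: compact_closed; exact: norm_hausdorff. Qed.

(** The topology of row vectors comes from the sup norm; this is the bridge
from Euclidean estimates to continuity. *)
Lemma lipschitz_continuous (f : 'rV[R]_d -> R) (k : R) :
  (forall x y, f x <= f y + k * edist x y) -> continuous f.
Proof.
move=> fk x; apply: (@cvgrPdist_lt _ _ _ (nbhs x) _ f (f x)).2 => e e0.
have k0 : 0 < `|k| + 1 by rewrite ltr_wpDl.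
apply/nbhs_eball; exists (e / (`|k| + 1)); first exact: divr_gt0.
move=> y; rewrite /eball/= ltr_pdivlMr// => xy.
have h := fk x y; have h' := fk y x; rewrite edistC in h'.
have : k * edist x y <= `|k| * edist x y.
  by rewrite ler_wpM2r ?edist_ge0// ler_norm.
have := edist_ge0 x y.
by move=> ? ?; rewrite ltr_norml; apply/andP; split; nra.
Qed.

Lemma edist_continuous y : continuous (edist ^~ y).
Proof.
by apply: (@lipschitz_continuous _ 1) => x z; rewrite mul1r addrC edist_triangle.
Qed.

Lemma le_edist_set x A (e : R) : A !=set0 ->
  (forall y, A y -> e <= edist x y) -> e <= edist_set x A.
Proof.
move=> [y Ay] eA; apply: lb_le_inf; first by exists (edist x y), y.
by move=> _ [z Az <-]; exact: eA.
Qed.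

Lemma edist_set_lipschitz x y A : A !=set0 ->
  edist_set x A <= edist_set y A + edist x y.
Proof.
move=> A0; rewrite -lerBlDr; apply: le_edist_set => // z Az.
rewrite lerBlDr addrC (le_trans (edist_set_le x Az))//.
exact: edist_triangle.
Qed.

Lemma edist_set_continuous A : A !=set0 -> continuous (edist_set ^~ A).
Proof.
move=> A0; apply: (@lipschitz_continuous _ 1) => x y.
by rewrite mul1r edist_set_lipschitz.
Qed.

Lemma edist_set_attained A x : compact A -> A !=set0 ->
  exists2 p, A p & edist_set x A = edist x p.
Proof.
move=> cA A0.
have [p pA pmin] : exists2 p, p \in A & forall q, q \in A -> edist p x <= edist q x.
  by apply: compact_EVT_min => //; exact/continuous_subspaceT/edist_continuous.
rewrite inE in pA; exists p => //; apply/eqP; rewrite eq_le edist_set_le//=.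
by apply: le_edist_set => // q Aq; rewrite edistC (edistC x) pmin ?inE.
Qed.

Lemma projection_edist_set A x p : projection A x p -> edist_set x A = edist x p.
Proof.
move=> [Ap pmin]; apply/eqP; rewrite eq_le edist_set_le//=.
by apply: le_edist_set => //; exists p.
Qed.

Lemma projection_exists A x : compact A -> A !=set0 -> exists p, projection A x p.
Proof.
move=> cA A0; have [p Ap xp] := edist_set_attained A x cA A0.
by exists p; split=> // z Az; rewrite -xp edist_set_le.
Qed.

Lemma compact_ceball x (h : R) : compact [set y | edist y x <= h].
Proof.
apply: bounded_closed_compact.
  exists (`|x| + h); split; first exact: num_real.
  move=> M hM y /= yx; rewrite (le_trans _ (ltW hM))// -{1}(subrK x y).
  rewrite (le_trans (ler_normD _ _))// addrC lerD2l.
  exact: le_trans (norm_le_enorm _) yx.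
apply: (@preimage_closed _ _ (edist ^~ x) [set t | t <= h]); last exact: closed_le.
by move=> y _; exact: edist_continuous.
Qed.

End euclidean_geometry.

(** * Federer's normal rays and prox-regularity *)

Section federer.
Context {R : realType} {d : nat}.
Implicit Types (x y z p q : 'rV[R]_d) (e : R) (A : set 'rV[R]_d).

(** For y = p + s u with |u| = 1 and s > 0, the inequality is equivalent to
2 r (b - p).u <= |b - p|^2, that is, to b lying outside the open ball of
centre p + r u and radius r. It is written with distances only, which makes
its stability under limits immediate and also covers y = p. *)
Definition prox_regular A (r : R) := forall y a, A a -> edist y a < r ->
  exists p, [/\ A p, edist y p <= edist y a & forall b, A b ->
    edist y p ^+ 2 + (1 - edist y p / r) * edist p b ^+ 2 <= edist y b ^+ 2].

Lemma reach_ge_Unp A (r : R) y a : (r%:E <= reach A)%E -> A a -> edist y a < r ->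
  Unp A y.
Proof.
move=> rA Aa ya.
have : ((edist y a)%:E < reach_at A a)%E.
  rewrite (@lt_le_trans _ _ r%:E) ?lte_fin// (le_trans rA)//.
  by apply: ereal_inf_lbound; exists a.
rewrite /reach_at lt_max => /orP[|/ereal_sup_gt[_ [rho [_ rhoA] <-]]].
  by rewrite lte_fin ltNge edist_ge0.
by rewrite lte_fin => yr; apply: rhoA; rewrite /eball/= edistC.
Qed.

(** At a point x with one nearest point p, moving straight away from p
increases the distance to A with slope 1. The points of A far from p are
farther from x than p by a margin, by compactness, and remain so for small
steps; for a point a close to p, the directions x - a and x - p nearly agree,
and the first variation of |x - a| is nearly 1. *)
Lemma slope_edist_set A x p (c : R) : compact A ->
    (forall q, projection A x q <-> q = p) -> x != p -> 0 <= c < 1 ->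
  exists2 e0 : R, 0 < e0 & forall e : R, 0 < e < e0 ->
    edist x p + c * e <= edist_set (x + (e / edist x p) *: (x - p)) A.
Proof.
move=> cA px xp /andP[c0 c1].
have [Ap pmin] : projection A x p by exact/px.
set D := edist x p; have D0 : 0 < D by rewrite edist_gt0.
have [m Dm mA] : exists2 m, D < m &
    forall a, A a -> (1 - c) * D <= edist p a -> m <= edist x a.
  pose A' := A `\` eball p ((1 - c) * D).
  have cA' : compact A'.
    apply: (subclosed_compact _ cA) => [|z []//].
    apply: closedI; first exact: compact_closed_rV.
    exact/open_closedC/open_eball.
  have [A'0|/set0P A'0] := eqVneq A' set0.
    exists (D + 1) => [|a Aa pa]; first by rewrite ltrDl.
    by have : A' a; [split=> //; rewrite /eball/=; apply/negP;
      rewrite -leNgt|rewrite A'0].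
  have [q [Aq pq] xq] := edist_set_attained A' x cA' A'0.
  exists (edist x q).
    rewrite lt_neqAle pmin// andbT; apply/eqP => Dxq.
    apply: pq; rewrite /eball/=; have -> : q = p.
      by apply/px; split=> // z Az; rewrite -Dxq; exact: pmin.
    by rewrite edistxx mulr_gt0// subr_gt0.
  move=> a Aa pa; rewrite -xq edist_set_le//; split=> //.
  by rewrite /eball/=; apply/negP; rewrite -leNgt.
exists ((m - D) / 2) => [|e /andP[e0 em]]; first by rewrite divr_gt0 ?subr_gt0.
set z := x + _ *: _.
have A0 : A !=set0 by exists p.
have xz : edist x z = e.
  rewrite edistC /z edist_addl (enormZ (e / D)) ger0_norm ?divr_ge0 ?ltW//.
  by rewrite -/(edist x p) -/D divfK// gt_eqF.
apply: le_edist_set => // a Aa.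
have [pa|pa] := leP ((1 - c) * D) (edist p a).
  have := mA _ Aa pa; have := edist_triangle z x a; rewrite xz; nra.
rewrite -(@ler_pXn2r _ 2)//
  ?nnegrE ?edist_ge0 ?addr_ge0 ?mulr_ge0 ?(ltW D0) ?(ltW e0)//.
have -> : edist z a ^+ 2 =
  edist x a ^+ 2 + 2 * (e / D) * dot (x - a) (x - p) + e ^+ 2.
  have -> : edist z a = enorm ((x - a) + (e / D) *: (x - p))
    by rewrite /edist /z addrAC.
  rewrite sqr_enormD enormZ ger0_norm ?divr_ge0 ?ltW// (dotC (x - a)) dotZl.
  rewrite (_ : enorm (x - p) = D)// divfK ?gt_eqF// (dotC (x - p)) mulrA.
  by [].
have -> : dot (x - a) (x - p) = D ^+ 2 - dot (a - p) (x - p).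
  rewrite /D /edist sqr_enorm_dot -dotNl -dotDl; congr dot.
  by rewrite opprB subrKA.
have dle : dot (a - p) (x - p) <= (1 - c) * D * D.
  apply: (le_trans (dot_le_enorm _ _)); rewrite ler_wpM2r ?enorm_ge0// ltW//.
  by rewrite -/(edist a p) edistC.
have Dxa : D ^+ 2 <= edist x a ^+ 2 by rewrite ler_sqr ?nnegrE ?edist_ge0 ?pmin ?ltW.
have : 2 * (e / D) * (c * D * D) <= 2 * (e / D) * (D ^+ 2 - dot (a - p) (x - p)).
  by apply: ler_wpM2l; [rewrite mulr_ge0// divr_ge0// ltW|nra].
have -> : 2 * (e / D) * (c * D * D) = 2 * e * c * D by field; rewrite gt_eqF.
have : (c * e) ^+ 2 <= e ^+ 2 by rewrite exprMn ler_piMl ?sqr_ge0// exprn_ile1// ltW.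
set T := 2 * (e / D) * _; move: Dxa; rewrite !expr2; clearbody T D; nra.
Qed.

(** The distance to A grows at unit speed, as long as it stays below r: over a
ball of radius h its maximum exceeds the value at the centre c by h. If not,
some slope k < 1 is such that distance(z) - k |z - c| is below its value at c
on the whole sphere, so its maximum over the ball is attained inside, at a
point with one nearest point, against [slope_edist_set]. *)
Lemma edist_set_grows A (r h : R) c : compact A -> A !=set0 ->
    (forall y, 0 < edist_set y A < r -> Unp A y) ->
    0 < h < edist_set c A -> edist_set c A + h < r ->
  exists2 z, edist z c <= h & edist_set c A + h <= edist_set z A.
Proof.
move=> cA A0 AU; set tau := edist_set c A => /andP[h0 htau] taur.
pose B := [set z | edist z c <= h].
have cB : compact B by exact: compact_ceball.
have Bc : B c by rewrite /B/= edistxx ltW.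
have B0 : B !=set0 by exists c.
have [z1 + z1max] : exists2 z1, z1 \in B &
    forall z, z \in B -> edist_set z A <= edist_set z1 A.
  by apply: compact_EVT_max => //; exact/continuous_subspaceT/edist_set_continuous.
rewrite inE => Bz1.
have [|z1lt] := leP (tau + h) (edist_set z1 A); first by exists z1.
set m := edist_set z1 A in z1lt z1max.
have taum : tau <= m by rewrite z1max ?inE.
(* Any k strictly between (m - tau) / h and 1 works; take the midpoint. *)
have [k [k0 k1 km]] : exists k : R, [/\ 0 <= k, k < 1 & m - k * h < tau].
  exists (((m - tau) / h + 1) / 2); split.
  - by rewrite divr_ge0// addr_ge0// divr_ge0 ?subr_ge0// ltW.
  - have : (m - tau) / h < 1 by rewrite ltr_pdivrMr// mul1r ltrBlDl.
    by lra.
  - have -> : ((m - tau) / h + 1) / 2 * h = (m - tau + h) / 2.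
      by field; rewrite gt_eqF.
    by lra.
pose phi z := edist_set z A - k * edist z c.
have phic : continuous phi.
  apply: (@lipschitz_continuous _ _ _ 2) => x y; rewrite /phi.
  have := edist_set_lipschitz x y A A0; have := edist_triangle x y c.
  by rewrite (edistC y x); have := edist_ge0 x y; nra.
have [z0 + z0max] : exists2 z0, z0 \in B & forall z, z \in B -> phi z <= phi z0.
  by apply: compact_EVT_max => //; exact/continuous_subspaceT.
rewrite inE => Bz0.
have tauphi : tau <= phi z0.
  by have := z0max c; rewrite inE /phi edistxx mulr0 subr0 => /(_ Bc).
(* On the sphere the penalised distance is below its value tau at c. *)
have z0h : edist z0 c < h.
  rewrite lt_neqAle Bz0 andbT; apply/eqP => z0h; move: tauphi.
  rewrite /phi z0h leNgt; apply/negP/negPn; rewrite (le_lt_trans _ km)// lerD2r.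
  by rewrite z1max ?inE.
have tauz0 : tau <= edist_set z0 A.
  by rewrite (le_trans tauphi)// gerBl mulr_ge0// edist_ge0.
have z0r : edist_set z0 A < r.
  by rewrite (le_lt_trans _ taur)// (le_trans _ (ltW z1lt))// z1max ?inE.
have tau0 : 0 < tau by exact: lt_trans htau.
have [|p [pz0 puniq]] := AU z0; first by rewrite z0r andbT (lt_le_trans tau0).
have px q : projection A z0 q <-> q = p.
  by split=> [/puniq/esym//|->].
have z0p : edist_set z0 A = edist z0 p := projection_edist_set _ _ _ pz0.
have pz0' : z0 != p by rewrite -edist_gt0 -z0p (lt_le_trans tau0).
have k'01 : 0 <= (k + 1) / 2 < 1 by apply/andP; split; lra.
have [e0 e00 slope] := slope_edist_set A z0 p _ cA px pz0' k'01.
pose e := Num.min (e0 / 2) (h - edist z0 c).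
have e_gt0 : 0 < e by rewrite lt_min subr_gt0 z0h divr_gt0.
have ee0 : e < e0 by rewrite gt_min ltr_pdivrMr// mulr_natr mulr2n ltrDl e00.
have eh : e <= h - edist z0 c by rewrite ge_min lexx orbT.
set z := z0 + (e / edist z0 p) *: (z0 - p).
have zz0 : edist z z0 = e.
  rewrite edist_addl enormZ ger0_norm ?divr_ge0 ?edist_ge0 ?(ltW e_gt0)//.
  by rewrite divfK// gt_eqF// edist_gt0.
have zc := edist_triangle z0 z c; rewrite zz0 in zc.
have Bz : z \in B by rewrite inE /B/=; lra.
have := z0max z Bz; rewrite /phi.
have := slope e; rewrite e_gt0 ee0 => /(_ isT); rewrite -/z -z0p.
have := ler_wpM2l k0 zc; rewrite mulrDr.
set w := k * _; set w' := k * e; set w'' := k * edist z0 c.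
have -> : (k + 1) / 2 * e = (w' + e) / 2 by rewrite /w'; field.
have : w' < e by rewrite /w' -[ltRHS]mul1r ltr_pM2r.
move=> ? ? ? ?; exfalso; lra.
Qed.

(** Let tau be the largest parameter up to which p stays nearest along the
ray. If tau < r, [edist_set_grows] gives a point z within h of p + tau u at
distance at least tau + h from A, hence from p. Equality in the triangle
inequality forces z = p + (tau + h) u, so p stays nearest beyond tau. *)
Lemma edist_set_normal_ray A (r s t : R) p u : compact A -> (r%:E <= reach A)%E ->
    enorm u = 1 -> projection A (p + s *: u) p -> 0 < s < r -> 0 <= t < r ->
  t <= edist_set (p + t *: u) A.
Proof.
move=> cA rA u1 sp /andP[s0 sr] /andP[t0 tr].
have A0 : A !=set0 by exists p; case: sp.
have AU y : 0 < edist_set y A < r -> Unp A y.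
  move=> /andP[_]; have [q Aq ->] := edist_set_attained A y cA A0.
  exact: reach_ge_Unp.
pose c (a : R) := p + a *: u.
have cc a b : edist (c a) (c b) = `|a - b|.
  by rewrite /edist /c opprD addrACA subrr add0r -scalerBl enormZ u1 mulr1.
have cp a : edist (c a) p = `|a| by rewrite edist_addl enormZ u1 mulr1.
pose T := [set a : R | a < r /\ a <= edist_set (c a) A].
have Ts : T s.
  by split=> //; rewrite (projection_edist_set _ _ _ sp) -/(c s) cp ler_norm.
have supT : has_sup T by split; [exists s|exists r => a [/ltW]].
have downT a b : T a -> b <= a -> T b.
  move=> [ar aT] ba; split; first exact: le_lt_trans ar.
  have := edist_set_lipschitz (c a) (c b) A A0.
  by rewrite cc ger0_norm ?subr_ge0//; lra.
suff [a Ta ta] : exists2 a, T a & t < a by have [] := downT a t Ta (ltW ta).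
have [rT|Tr] := leP r (sup T).
  have tsup : 0 < sup T - t by rewrite subr_gt0 (lt_le_trans tr).
  by have [a Ta] := sup_adherent tsup supT; rewrite subKr; exists a.
exfalso; set tau := sup T in Tr.
have stau : s <= tau by exact: sup_upper_bound.
have tau0 : 0 < tau by exact: lt_le_trans stau.
have Ttau : edist_set (c tau) A = tau.
  apply/eqP; rewrite eq_le; apply/andP; split.
    rewrite (le_trans (edist_set_le _ (proj1 sp)))// cp ger0_norm//.
    exact: ltW.
  apply/ler_addgt0Pl => e e0.
  have e20 : 0 < e / 2 by rewrite divr_gt0.
  have [a Ta] := sup_adherent e20 supT; rewrite -/tau => ea.
  have atau : a <= tau by exact: sup_upper_bound.
  have := edist_set_lipschitz (c a) (c tau) A A0.
  rewrite cc ler0_norm ?subr_le0//.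
  have [_ aT] := Ta; lra.
pose h := Num.min (tau / 2) ((r - tau) / 2).
have h0 : 0 < h by rewrite lt_min !divr_gt0// subr_gt0.
have htau : h < tau.
  by rewrite gt_min ltr_pdivrMr// mulr_natr mulr2n ltrDl tau0.
have hr : tau + h < r.
  have : h <= (r - tau) / 2 by rewrite ge_min lexx orbT.
  by lra.
have [||z zh zA] := edist_set_grows A r h (c tau) cA A0 AU; rewrite ?Ttau ?h0//.
have zp : tau + h <= edist z p.
  by rewrite -{1}Ttau (le_trans zA)// edist_set_le//; case: sp.
have zE : z = c (tau + h).
  pose w := z - c tau.
  have : edist z p ^+ 2 = enorm w ^+ 2 + 2 * tau * dot w u + tau ^+ 2.
    have -> : edist z p = enorm (w + tau *: u).
      by rewrite /w /c opprD addrA subrK.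
    by rewrite sqr_enormD dotC dotZl enormZ u1 mulr1 real_normK ?num_real//
      dotC mulrA.
  have : enorm (w + (- h) *: u) ^+ 2 = enorm w ^+ 2 - 2 * h * dot w u + h ^+ 2.
    rewrite sqr_enormD dotC dotZl enormZ u1 mulr1 real_normK ?num_real// dotC sqrrN.
    by ring.
  have wh : enorm w ^+ 2 <= h ^+ 2 by rewrite ler_sqr ?nnegrE ?enorm_ge0// ltW.
  (* Equality in the triangle inequality: |w| <= h and |w + tau u| >= tau + h
     force w.u >= h, hence |w - h u|^2 <= 0. *)
  move=> wE zE.
  have : (tau + h) ^+ 2 <= edist z p ^+ 2.
    by rewrite ler_sqr ?nnegrE ?edist_ge0// addr_ge0 ?ltW.
  rewrite zE => hw; have hX : h <= dot w u.
    by rewrite -(@ler_pM2l _ (2 * tau)) ?mulr_gt0//; nra.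
  have : enorm (w + (- h) *: u) ^+ 2 <= 0 by rewrite wE; nra.
  rewrite le_eqVlt ltNge sqr_ge0 orbF sqrf_eq0 enorm_eq0 /w.
  rewrite scaleNr -addrA -opprD subr_eq0 => /eqP ->.
  by rewrite /c -addrA -scalerDl.
have : T (tau + h) by split=> //; rewrite -zE -{1}Ttau.
by move/(sup_upper_bound supT); rewrite -/tau; lra.
Qed.

(** All points p + t u with t < r being at distance t from A, each b of A
satisfies 0 <= |p - b|^2 + 2 t (p - b).u; the limit t = r is the assertion,
after multiplication by |y - p| / r. *)
Lemma reach_prox_regular A (r : R) : 0 < r -> compact A -> (r%:E <= reach A)%E ->
  prox_regular A r.
Proof.
move=> r0 cA rA y a Aa ya.
have A0 : A !=set0 by exists a.
have [p yp] := projection_exists A y cA A0.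
have [Ap pmin] := yp.
exists p; split=> // [|b Ab]; first exact: pmin.
have [->|ypneq] := eqVneq y p.
  by rewrite edistxx expr0n mul0r subr0 mul1r add0r.
set s := edist y p; have s0 : 0 < s by rewrite edist_gt0.
have sr : s < r by rewrite (le_lt_trans _ ya)// pmin.
pose u := s^-1 *: (y - p).
have u1 : enorm u = 1.
  by rewrite enormZ ger0_norm ?invr_ge0 ?(ltW s0)// mulVf// gt_eqF.
have yE : y = p + s *: u.
  by rewrite scalerA divff ?gt_eqF// scale1r addrC subrK.
have expand (t : R) : edist (p + t *: u) b ^+ 2 =
    edist p b ^+ 2 + 2 * t * dot (p - b) u + t ^+ 2.
  have -> : edist (p + t *: u) b = enorm ((p - b) + t *: u) by rewrite /edist addrAC.
  rewrite sqr_enormD dotC dotZl dotC enormZ u1 mulr1.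
  by rewrite real_normK ?num_real// mulrA.
have ray (t : R) : 0 <= t < r -> 0 <= edist p b ^+ 2 + 2 * t * dot (p - b) u.
  move=> /andP[t0 tr].
  have tA : t <= edist (p + t *: u) b.
    apply: le_trans (edist_set_le _ Ab).
    apply: (@edist_set_normal_ray _ r s) => //; rewrite ?t0 ?s0 -?yE//.
  have : t ^+ 2 <= edist (p + t *: u) b ^+ 2 by rewrite ler_sqr ?nnegrE ?edist_ge0.
  by rewrite expand lerDr.
have : 0 <= edist p b ^+ 2 + 2 * r * dot (p - b) u.
  set P := edist p b ^+ 2 in ray *; set beta := dot _ _ in ray *.
  have P0 : 0 <= P by exact: sqr_ge0.
  rewrite leNgt; apply/negP => neg.
  have beta0 : beta < 0 by nra.
  (* The expression vanishes at t = q < r and decreases after q. *)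
  pose q := P / (- 2 * beta).
  have qE : q * beta = - P / 2 by rewrite /q; field; rewrite lt_eqF.
  have q0 : 0 <= q by rewrite divr_ge0//; nra.
  have qr : q < r by nra.
  have := ray ((q + r) / 2); rewrite (_ : 0 <= _ < _); last by apply/andP;
    split; lra.
  by move=> /(_ isT); nra.
rewrite {1}yE expand => H.
have := mulr_ge0 (divr_ge0 (ltW s0) (ltW r0)) H.
have -> : s / r * (edist p b ^+ 2 + 2 * r * dot (p - b) u) =
  s / r * edist p b ^+ 2 + 2 * s * dot (p - b) u by field; rewrite gt_eqF.
set X := s / r * _ => HX.
have -> : (1 - s / r) * edist p b ^+ 2 = edist p b ^+ 2 - X by rewrite mulrBl mul1r.
by lra.
Qed.

(** Since |y - p| < r, the coefficient of |p - b|^2 is positive: p is nearest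
to y, and equality |y - b| = |y - p| forces b = p. *)
Lemma prox_regular_reach A (r : R) : 0 < r -> prox_regular A r ->
  (r%:E <= reach A)%E.
Proof.
move=> r0 pA; apply: le_ereal_inf_tmp => _ [x Ax <-].
rewrite /reach_at le_max; apply/orP; right; apply: ereal_sup_ubound.
exists r => //; split=> // y; rewrite /eball/= edistC => yx.
have [p [Ap px pb]] := pA y x Ax yx.
have yr : edist y p < r by exact: le_lt_trans yx.
have k0 : 0 < 1 - edist y p / r by rewrite subr_gt0 ltr_pdivrMr// mul1r.
have pmin z : A z -> edist y p <= edist y z.
  move=> Az; rewrite -(@ler_pXn2r _ 2)// ?nnegrE ?edist_ge0//.
  by rewrite (le_trans _ (pb _ Az))// lerDl mulr_ge0 ?sqr_ge0// ltW.
exists p; split=> // q [Aq qmin].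
have yqp : edist y q = edist y p by apply/eqP; rewrite eq_le qmin//= pmin.
have := pb _ Aq; rewrite yqp gerDl pmulr_rle0//.
rewrite le_eqVlt ltNge sqr_ge0 orbF sqrf_eq0 edist_eq0 => /eqP//.
Qed.

End federer.

(** * Boundaries and the holes next to them *)

Section boundary.
Context {R : realType} {d : nat}.
Implicit Types (x y z p q : 'rV[R]_d) (e : R) (A K : set 'rV[R]_d).

Lemma closure_edistP A x :
  closure A x <-> forall e, 0 < e -> exists2 y, A y & edist x y < e.
Proof.
split=> [Ax e e0|Ax B /nbhs_eball[e e0 eB]].
  by have [y [Ay xy]] := Ax _ (eball_nbhs x _ e0); exists y.
by have [y Ay xy] := Ax e e0; exists y; split=> //; exact: eB.
Qed.

Lemma closed_boundary A : closed (boundary A).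
Proof.
apply: closedI; first exact: closed_closure.
exact/open_closedC/open_interior.
Qed.

Lemma boundaryP A x : closed A ->
  boundary A x <-> A x /\ forall e, 0 < e -> exists2 y, ~ A y & edist x y < e.
Proof.
move=> cA; rewrite /boundary -(closure_id A).1//; split=> -[Ax nAx]; split=> //.
  move=> e e0; apply: contrapT => noy; apply: nAx; apply/nbhs_eball.
  by exists e => // y xy; apply: contrapT => nAy; apply: noy; exists y.
by move=> /nbhs_eball[e e0 eA]; have [y nAy /eA] := nAx e e0.
Qed.

Lemma boundary_sub A : closed A -> boundary A `<=` A.
Proof. by move=> cA x /(boundaryP _ _ cA)[]. Qed.

(** Points strictly between p and y are closer to y than p, hence outside
A. This produces boundary points with no appeal to connectedness. *)
Lemma projection_boundary A y p : closed A -> ~ A y -> projection A y p ->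
  boundary A p.
Proof.
move=> cA nAy [Ap pmin]; apply/boundaryP => //; split=> // e e0.
set s := edist y p; have s0 : 0 <= s by exact: edist_ge0.
have s_gt0 : 0 < s by rewrite edist_gt0; apply/eqP => yp; apply: nAy; rewrite yp.
pose k := e / (s + e).
have se0 : 0 < s + e by rewrite ltr_wpDl.
have k0 : 0 < k by rewrite divr_gt0.
have k1 : k < 1 by rewrite ltr_pdivrMr// mul1r ltrDr.
exists (p + k *: (y - p)).
  move=> /pmin; rewrite -/s.
  have -> : edist y (p + k *: (y - p)) = (1 - k) * s.
    rewrite -(ger0_norm (_ : 0 <= 1 - k)) ?subr_ge0 ?(ltW k1)//.
    by rewrite -enormZ scalerBl scale1r /edist opprD addrA.
  by apply/negP; rewrite -ltNge mulrBl mul1r gtrBl mulr_gt0.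
rewrite edistC edist_addl enormZ -/(edist y p) -/s ger0_norm ?(ltW k0)//.
by rewrite /k mulrAC ltr_pdivrMr// ltr_pM2l// ltrDl.
Qed.

(** Take y outside A very close to x, its nearest point p, and the point at
distance t from p on the ray from p through y. *)
Lemma boundary_hole A (r t e : R) x : closed A -> prox_regular A r ->
    0 < t < r -> 0 < e -> boundary A x ->
  exists2 c, edist c x < t + e & forall a, A a -> t <= edist c a.
Proof.
move=> cA pA /andP[t0 tr] e0 /(boundaryP _ _ cA)[Ax nAx].
have r0 : 0 < r by exact: lt_trans tr.
(* Closer than e / 2 so that c is within t + e of x, closer than r so that y
   has a nearest point to which prox-regularity applies. *)
pose e' := Num.min (e / 2) r.
have e'0 : 0 < e' by rewrite lt_min r0 divr_gt0.
have e'e : e' <= e / 2 by rewrite ge_min lexx.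
have e'r : e' <= r by rewrite ge_min lexx orbT.
have [y nAy xy] := nAx e' e'0.
have [p [Ap yp pb]] := pA y x Ax
  (lt_le_trans (etrans (congr1 (< e') (edistC y x)) xy) e'r).
set s := edist y p in yp pb *.
have s0 : 0 < s by rewrite edist_gt0; apply/eqP => yp'; apply: nAy; rewrite yp'.
pose c := p + (t / s) *: (y - p).
have cp : edist c p = t.
  rewrite edist_addl enormZ -/(edist y p) -/s ger0_norm ?divr_ge0 ?ltW//.
  by rewrite divfK// gt_eqF.
exists c.
  have := edist_triangle p c x; have := edist_triangle y p x.
  by rewrite cp (edistC p y) -/s; rewrite edistC in xy; lra.
move=> a Aa; rewrite -(@ler_pXn2r _ 2)// ?nnegrE ?edist_ge0 ?(ltW t0)//.
have := pb _ Aa.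
have -> : edist y a ^+ 2 = edist p a ^+ 2 + 2 * dot (p - a) (y - p) + s ^+ 2.
  rewrite /s /edist -sqr_enormD; congr (enorm _ ^+ 2).
  by rewrite [RHS]addrC subrKA.
have -> : edist c a ^+ 2 =
    edist p a ^+ 2 + 2 * (t / s) * dot (p - a) (y - p) + t ^+ 2.
  have -> : edist c a = enorm ((p - a) + (t / s) *: (y - p)).
    by rewrite /edist /c addrAC.
  have tE : enorm ((t / s) *: (y - p)) = t by rewrite -[RHS]cp edist_addl.
  by rewrite sqr_enormD tE dotC dotZl dotC mulrA.
set P := edist p a ^+ 2; set b := dot _ _ => H.
have P0 : 0 <= P by exact: sqr_ge0.
have H1 : 0 <= s / r * P + 2 * b by move: H; rewrite mulrBl mul1r; lra.
have H2 : 0 <= t / s * (s / r * P + 2 * b) by rewrite mulr_ge0// divr_ge0 ?ltW.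
have E : t / s * (s / r * P + 2 * b) = t / r * P + 2 * (t / s) * b.
  by field; rewrite !gt_eqF.
have : t / r * P <= P by rewrite ler_piMl// ler_pdivrMr// mul1r ltW.
by move: H2; rewrite E; lra.
Qed.

End boundary.

(** * Limits of sets along an ultrafilter *)

Section ultralimit.
Context {R : realType} {d : nat} {I : Type} (F : set_system I) {FU : UltraFilter F}.
Context (K : set 'rV[R]_d) (cK : compact K).
Implicit Types (x y z p q : 'rV[R]_d) (e : R) (A : set 'rV[R]_d).

(** An ultrafilter decides whether f is eventually in a given ball around a
cluster point, so f converges to each of its cluster points. *)
Lemma ultra_cvg (f : I -> 'rV[R]_d) : F [set i | K (f i)] ->
  exists2 x, K x & forall e, 0 < e -> F [set i | edist x (f i) < e].
Proof.
move=> FK; have [x [Kx xF]] := cK (f @ F) _ FK; exists x => // e e0.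
have [//|Fn] := in_ultra_setVsetC [set i | edist x (f i) < e] FU.
have [y [/= xy1 xy2]] := xF (~` eball x e) _ Fn (eball_nbhs x _ e0).
by [].
Qed.

(** The only way for D i not to be eventually within e of E i, uniformly, is
that some points of D i at distance at least e from E i converge. This is how
compactness of K turns pointwise closeness into Hausdorff closeness. *)
Lemma ultra_escape (D E : I -> set 'rV[R]_d) (e : R) :
    F [set i | D i `<=` K] ->
    ~ F [set i | forall x, D i x -> exists2 y, E i y & edist x y < e] ->
  exists f, exists x, [/\ K x, forall e', 0 < e' -> F [set i | edist x (f i) < e'] &
    F [set i | D i (f i) /\ forall y, E i y -> e <= edist (f i) y]].
Proof.
move=> DK nF.
pose Q i x := D i x /\ forall y, E i y -> e <= edist x y.
pose f i := xget 0 (Q i).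
have fQ : F [set i | Q i (f i)].
  have [/nF//|] := in_ultra_setVsetC
    [set i | forall x, D i x -> exists2 y, E i y & edist x y < e] FU.
  apply: filterS => i /= /existsNP[x /not_implyP[Dx nE]].
  apply: (@xgetPex _ 0 (Q i)); exists x; split=> // y Ey.
  by rewrite leNgt; apply/negP => xy; apply: nE; exists y.
have [|x Kx xf] := ultra_cvg f; last by exists f, x.
by move: DK fQ; apply: filterS2 => i DK [/DK].
Qed.

Definition set_limit (G : I -> set 'rV[R]_d) := [set x | forall e, 0 < e ->
  F [set i | exists2 y, G i y & edist x y < e]].

Lemma closed_set_limit G : closed (set_limit G).
Proof.
move=> x /closure_edistP xL e e0.
have e20 : 0 < e / 2 by rewrite divr_gt0.
have [y yL xy] := xL _ e20.
apply: filterS (yL _ e20) => i [z Gz yz]; exists z => //.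
by rewrite (le_lt_trans (edist_triangle y _ _))// [e]splitr ltrD.
Qed.

Context (r : R) (r0 : 0 < r) (G : I -> set 'rV[R]_d).
Hypothesis GK : F [set i |
  [/\ G i `<=` K, G i !=set0, closed (G i) & prox_regular (G i) r]].

Let L := set_limit G.

Lemma set_limit_sub : L `<=` K.
Proof.
move=> x Lx; apply: (compact_closed_rV _ cK); apply/closure_edistP => e e0.
have [i [[GiK _ _ _] [y Gy xy]]] := filter_ex (filterI GK (Lx e e0)).
by exists y => //; exact: GiK.
Qed.

Lemma set_limit_nonempty : L !=set0.
Proof.
pose f i := xget 0 (G i).
have fG : F [set i | G i (f i)].
  by apply: filterS GK => i [_ [y Gy] _ _]; apply: xgetPex; exists y.
have [|x Kx xf] := ultra_cvg f.
  by move: GK fG; apply: filterS2 => i [GK' _ _ _]; exact: GK'.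
exists x => e e0; move: fG (xf e e0).
by apply: filterS2 => i Gf xfi; exists (f i).
Qed.

Lemma set_limit_near_sub e : 0 < e ->
  F [set i | forall x, L x -> exists2 y, G i y & edist x y < e].
Proof.
move=> e0; apply: contrapT => /ultra_escape[].
  by apply: filterE => i; exact: set_limit_sub.
move=> f [x [Kx xf fL]].
have e20 : 0 < e / 2 by rewrite divr_gt0.
have Lx : L x.
  apply: closed_set_limit; apply/closure_edistP => e' e'0.
  by have [i [xfi [Lf _]]] := filter_ex (filterI (xf _ e'0) fL); exists (f i).
have [i [[xfi [_ fG]] [y Gy xy]]] :=
  filter_ex (filterI (filterI (xf _ e20) fL) (Lx _ e20)).
have := fG _ Gy; have := edist_triangle x (f i) y; rewrite (edistC (f i) x).
by move: xfi => /=; lra.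
Qed.

Lemma set_limit_near_sup e : 0 < e ->
  F [set i | forall y, G i y -> exists2 x, L x & edist y x < e].
Proof.
move=> e0; apply: contrapT => /(ultra_escape G (fun=> L))[].
  by apply: filterS GK => i [].
move=> f [x [Kx xf fL]].
have Lx : L x.
  move=> e' e'0; move: (xf _ e'0) fL; apply: filterS2 => i xfi [Gf _].
  by exists (f i).
have [i [xfi [_ fG]]] := filter_ex (filterI (xf _ e0) fL).
by have := fG _ Lx; rewrite edistC leNgt xfi.
Qed.

Lemma cvg_edist (a b : I -> 'rV[R]_d) x y :
  (forall e, 0 < e -> F [set i | edist x (a i) < e]) ->
  (forall e, 0 < e -> F [set i | edist y (b i) < e]) ->
  edist (a i) (b i) @[i --> F] --> edist x y.
Proof.
move=> ax ay; apply/cvgrPdist_lt => e e0.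
have e20 : 0 < e / 2 by rewrite divr_gt0.
apply: filterS2 (ax _ e20) (ay _ e20) => i /= xi yi.
have := edist_triangle (a i) x y; have := edist_triangle (b i) (a i) y.
have := edist_triangle x (a i) (b i); have := edist_triangle y x (b i).
rewrite (edistC (b i) y) (edistC (a i) x) => *.
by rewrite ltr_norml; apply/andP; split; lra.
Qed.

(** The nearest points in G i to y converge to a point p of the limit, each
point b of the limit is a limit of its nearest points in G i, and the
inequality passes to the limit. *)
Lemma set_limit_prox_regular : prox_regular L r.
Proof.
move=> y a La ya.
pose s := (edist y a + r) / 2.
have [as_ sr] : edist y a < s /\ s < r by rewrite /s; split; lra.
pose Q i := [set p | [/\ G i p, edist y p < s & forall b, G i b ->
    edist y p ^+ 2 + (1 - edist y p / r) * edist p b ^+ 2 <= edist y b ^+ 2]].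
pose f i := xget 0 (Q i).
have sa : 0 < s - edist y a by rewrite subr_gt0.
have fQ : F [set i | Q i (f i)].
  move: GK (La _ sa); apply: filterS2 => i [_ _ _ Gpr] [a' Ga' aa'].
  apply: (@xgetPex _ 0 (Q i)).
  have ya' : edist y a' < s.
    by have := edist_triangle a y a'; lra.
  have [p [Gp yp pb]] := Gpr y a' Ga' (lt_trans ya' sr).
  by exists p; split=> //; exact: le_lt_trans ya'.
have [|p Kp pf] := ultra_cvg f.
  by move: GK fQ; apply: filterS2 => i [GK' _ _ _] [/GK'].
have Lp : L p.
  by move=> e e0; move: fQ (pf _ e0); apply: filterS2 => i [Gf _ _]; exists (f i).
have y_cvg : forall e, 0 < e -> F [set i | edist y y < e].
  by move=> e e0; apply: filterE => i /=; rewrite edistxx.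
have yp_cvg := cvg_edist _ _ _ _ y_cvg pf.
have pb b : L b ->
    edist y p ^+ 2 + (1 - edist y p / r) * edist p b ^+ 2 <= edist y b ^+ 2.
  move=> Lb; pose g i := xget 0 (projection (G i) b).
  have gP : F [set i | projection (G i) b (g i)].
    apply: filterS GK => i [GK' G0 cG _]; apply: xgetPex.
    by apply: projection_exists => //; exact: subclosed_compact cK _.
  have bg e : 0 < e -> F [set i | edist b (g i) < e].
    move=> e0; move: gP (Lb _ e0); apply: filterS2 => i [_ gmin] [z Gz bz].
    exact: le_lt_trans (gmin _ Gz) bz.
  have yb_cvg := cvg_edist _ _ _ _ y_cvg bg.
  have pb_cvg := cvg_edist _ _ _ _ pf bg.
  have sqr_cvg (u : I -> R) (l : R) : u i @[i --> F] --> l ->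
    u i ^+ 2 @[i --> F] --> l ^+ 2.
    by move=> ul; under eq_fun do rewrite expr2; rewrite expr2; exact: cvgM.
  rewrite -subr_ge0; apply: (@cvgr_to_ge _ F _ R (fun i => edist y (g i) ^+ 2 -
    (edist y (f i) ^+ 2 + (1 - edist y (f i) / r) * edist (f i) (g i) ^+ 2))).
    apply: cvgB; first exact: sqr_cvg.
    apply: cvgD; first exact: sqr_cvg.
    apply: cvgM; last exact: sqr_cvg.
    by apply: cvgB; [exact: cvg_cst|apply: cvgMr_tmp].
  by move: fQ gP; apply: filterS2 => i [_ _ fb] [Gg _]; rewrite subr_ge0; exact: fb.
exists p; split=> //.
have ps : edist y p <= s.
  apply: (@cvgr_to_le _ F _ R (fun i => edist y (f i))) => //.
  by move: fQ; apply: filterS => i [_ /ltW].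
rewrite -(@ler_pXn2r _ 2)// ?nnegrE ?edist_ge0//.
rewrite (le_trans _ (pb a La))// lerDl mulr_ge0 ?sqr_ge0// subr_ge0.
by rewrite ler_pdivrMr// mul1r (le_trans ps)// ltW.
Qed.

Let closed_L : closed L. Proof. exact: closed_set_limit. Qed.

(** Otherwise boundary points f i of the limit converge to x while the
boundary of G i keeps at distance e from f i. A point z outside L close to x
is then not outside G i, since its nearest point in G i would be a boundary
point of G i close to f i. So z belongs to L. *)
Lemma boundary_set_limit_near_sub e : 0 < e ->
  F [set i | forall x, boundary L x -> exists2 y, boundary (G i) y & edist x y < e].
Proof.
move=> e0; apply: contrapT => /(ultra_escape (fun=> boundary L))[].
  by apply: filterE => i x /(boundary_sub _ closed_L); exact: set_limit_sub.
move=> f [x [Kx xf fL]].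
have bLx : boundary L x.
  apply: closed_boundary; apply/closure_edistP => e' e'0.
  by have [i [xfi [Lf _]]] := filter_ex (filterI (xf _ e'0) fL); exists (f i).
have [Lx nLx] := (boundaryP _ _ closed_L).1 bLx.
have e8 : 0 < e / 8 by rewrite divr_gt0.
have [z nLz xz] := nLx _ e8.
apply: nLz => e' e'0.
apply: filterS2 GK (filterI (filterI (xf _ e8) fL) (Lx _ e8)) =>
  i [GiK G0 cG Gpr] [[xfi [_ fG]] [y Gy xy]].
suff Gz : G i z by exists z; rewrite ?edistxx.
apply: contrapT => nGz.
have [p zp] : exists p, projection (G i) z p.
  by apply: projection_exists => //; exact: subclosed_compact cK _.
have := fG _ (projection_boundary _ _ _ cG nGz zp).
have [_ /(_ _ Gy)] := zp; have := edist_triangle x z y;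
  have := edist_triangle x (f i) p.
have := edist_triangle z x p; rewrite (edistC z x) (edistC (f i) x).
by move: xfi => /=; lra.
Qed.

(** Otherwise boundary points f i of G i converge to an interior point x of
the limit. A hole of radius t next to f i has its centre in L, so it has
points of G i within t / 2. *)
Lemma boundary_set_limit_near_sup e : 0 < e ->
  F [set i | forall y, boundary (G i) y -> exists2 x, boundary L x & edist y x < e].
Proof.
move=> e0; apply: contrapT => /(ultra_escape
  (fun i => boundary (G i)) (fun=> boundary L))[].
  by apply: filterS GK => i [GK' _ cG _] x /(boundary_sub _ cG); exact: GK'.
move=> f [x [Kx xf fL]].
have Lx : L x.
  move=> e' e'0; move: GK (xf _ e'0) fL; apply: filterS3 => i [_ _ cG _] xfi [Gf _].
  by exists (f i) => //; exact: boundary_sub Gf.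
have nbLx : ~ boundary L x.
  move=> bLx; have [i [xfi [_ fG]]] := filter_ex (filterI (xf _ e0) fL).
  by have := fG _ bLx; rewrite edistC leNgt xfi.
have [rho rho0 rhoL] : exists2 rho : R, 0 < rho & forall z, edist x z < rho -> L z.
  apply: contrapT => norho; apply: nbLx; apply/boundaryP => //; split=> // e' e'0.
  apply: contrapT => noy; apply: norho; exists e' => // z xz.
  by apply: contrapT => nLz; apply: noy; exists z.
pose t := Num.min (rho / 4) (r / 2).
have t0 : 0 < t by rewrite lt_min !divr_gt0.
have trho : t <= rho / 4 by rewrite ge_min lexx.
have tr : t < r.
  have tr2 : t <= r / 2 by rewrite ge_min lexx orbT.
  by rewrite (le_lt_trans tr2)// ltr_pdivrMr// mulr_natr mulr2n ltrDl.
have t20 : 0 < t / 2 by rewrite divr_gt0.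
have rho4 : 0 < rho / 4 by rewrite divr_gt0.
have [i [[[_ _ cG Gpr] [bGf _]] [xfi LG]]] := filter_ex (filterI (filterI GK fL)
  (filterI (xf _ rho4) (set_limit_near_sub _ t20))).
have t0r : 0 < t < r by rewrite t0.
have [c cf cG'] := boundary_hole _ _ _ _ _ cG Gpr t0r rho4 bGf.
have [|a Ga ca] := LG c.
  by apply: rhoL; have := edist_triangle (f i) x c; rewrite (edistC (f i) c);
    move: xfi => /=; lra.
by have := cG' _ Ga; lra.
Qed.

End ultralimit.

(** * Compactness of the class of boundaries *)

Section boundaries_of_the_class.
Context {R : realType} {d : nat} (d_gt0 : (0 < d)%N).
Context (K : set 'rV[R]_d) (cK : compact K) (r : R) (r0 : 0 < r).
Implicit Types (a x y z p q : 'rV[R]_d) (A B E : set 'rV[R]_d) (s e eta : R).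

Lemma reach_class_compact A : reach_class K r A -> compact A.
Proof. by move=> [AK _ cA _]; exact: subclosed_compact cK AK. Qed.

Lemma reach_classP A : reach_class K r A <->
  [/\ A `<=` K, A !=set0, closed A & prox_regular A r].
Proof.
split=> [KA|[AK A0 cA pA]]; last by split=> //; exact: prox_regular_reach.
have cA := reach_class_compact A KA; have [AK A0 clA rA] := KA.
by split=> //; exact: reach_prox_regular.
Qed.

(** A compact set is not the whole space, as the dimension is positive, and
the point nearest to an outside point is a boundary point. *)
Lemma boundary_nonempty A : compact A -> A !=set0 -> boundary A !=set0.
Proof.
move=> cA A0; have [M [_ AM]] : bounded_set A := compact_bounded cA.
have nAy : ~ A (const_mx (`|M| + 2)).
  move=> Ay; have M1 : M < `|M| + 1 by rewrite (le_lt_trans (ler_norm _))// ltrDl.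
  have := AM _ M1 _ Ay; rewrite /= leNgt => /negP; apply.
  have /lt_le_trans : `|M| + 1 < `|M| + 2 by rewrite ltrD2l ltr1n.
  apply; rewrite -[leRHS]/(mx_norm _) mx_normrE.
  have := le_bigmax 0 (fun ij => `|(const_mx (`|M| + 2) : 'rV[R]_d) ij.1 ij.2|)
    (0, Ordinal d_gt0).
  by rewrite /= mxE ger0_norm// addr_ge0.
have [p yp] := projection_exists A (const_mx (`|M| + 2)) cA A0.
by exists p; exact: (projection_boundary _ _ _ (compact_closed_rV _ cA) nAy yp).
Qed.

Lemma boundary_hyperspace A : compact A -> A !=set0 ->
  exists X : hyperspace R d, hset X = boundary A.
Proof.
move=> cA A0.
have bA : bounded_set (boundary A).
  have [M [Mr AM]] : bounded_set A := compact_bounded cA.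
  exists M; split=> // N MN x /(boundary_sub _ (compact_closed_rV _ cA)).
  exact: AM.
by exists (Hyperspace (closed_boundary A) bA (boundary_nonempty A cA A0)).
Qed.

(** Reduces convergence in the hyperspace to the uniform closeness of points
obtained along ultrafilters. *)
Lemma hausdorff_dist_le A B e : 0 < e ->
  (forall x, A x -> exists2 y, B y & edist x y < e) ->
  (forall y, B y -> exists2 x, A x & edist y x < e) -> hausdorff_dist A B <= e.
Proof.
move=> e0 AB BA; apply: ge_inf; first by exists 0 => z [/ltW].
split=> // x.
- by move=> /BA[y Ay xy]; exact: le_trans (edist_set_le _ Ay) (ltW xy).
- by move=> /AB[y By xy]; exact: le_trans (edist_set_le _ By) (ltW xy).
Qed.

(** Each boundary is the boundary of a chosen set of the class; along an
ultrafilter these sets have a limit in the class, and their boundaries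
converge to the boundary of the limit. *)
Lemma compact_boundary_class :
  compact [set X : hyperspace R d | (boundary @` reach_class K r) (hset X)].
Proof.
rewrite compact_ultra => F FU FS.
pose G (X : hyperspace R d) :=
  xget set0 [set A | reach_class K r A /\ boundary A = hset X].
have FG : F [set X | reach_class K r (G X) /\ boundary (G X) = hset X].
  apply: filterS FS => X [A KA AX].
  by apply: (xgetPex set0 (P :=
    [set A | reach_class K r A /\ boundary A = hset X])); exists A.
have FG' : F [set X | [/\ G X `<=` K, G X !=set0,
  closed (G X) & prox_regular (G X) r]].
  by apply: filterS FG => X [/reach_classP].
pose L := set_limit F G.
have KL : reach_class K r L.
  apply/reach_classP; split.
  - exact: set_limit_sub FG'.
  - exact: set_limit_nonempty FG'.
  - exact: closed_set_limit.
  - exact: set_limit_prox_regular FG'.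
have [_ L0 _ _] := KL.
have [X XL] := boundary_hyperspace L (reach_class_compact _ KL) L0.
exists X; split; first by exists L.
move=> B /nbhs_ballP[e /= e0]; rewrite ballEmdist => eB.
have e20 : 0 < e / 2 by rewrite divr_gt0.
have h1 := boundary_set_limit_near_sub _ _ cK _ _ FG' _ e20.
have h2 := boundary_set_limit_near_sup _ _ cK _ r0 _ FG' _ e20.
suff : F B by [].
apply: filterS3 FG (h1 FU) (h2 FU) => Y [_ bY] Y1 Y2; apply: eB.
rewrite /= mdist_hyperspaceE (@le_lt_trans _ _ (e / 2))//; last first.
  by rewrite ltr_pdivrMr// mulr_natr mulr2n ltrDl.
by apply: hausdorff_dist_le => //; rewrite XL -bY.
Qed.

End boundaries_of_the_class.

(** * The boundary is porous, hence Lebesgue null *)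

Section porosity.
Context {R : realType} {d : nat}.
Implicit Types (a x y z p q : 'rV[R]_d) (A E K : set 'rV[R]_d) (s e : R).

Definition cube a s : set 'rV[R]_d := box a (a + const_mx s).

Lemma cubeP a s x : cube a s x <-> forall i, 0 <= x 0 i - a 0 i <= s.
Proof.
by split=> H i; have := H i; rewrite !mxE subr_ge0 lerBlDl.
Qed.

Definition subcube (N : nat) a s (f : {ffun 'I_d -> 'I_N}) : 'rV[R]_d :=
  \row_i (a 0 i + (f i)%:R * (s / N%:R)).

Lemma subcube_cover (N : nat) a s x : (0 < N)%N -> 0 < s -> cube a s x ->
  exists f : {ffun 'I_d -> 'I_N}, cube (subcube N a s f) (s / N%:R) x.
Proof.
move=> N0 s0 /cubeP xa.
have N0' : 0 < N%:R :> R by rewrite ltr0n.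
have sN0 : 0 < s / N%:R by rewrite divr_gt0.
have fex i : exists k : 'I_N,
  k%:R * (s / N%:R) <= x 0 i - a 0 i <= k.+1%:R * (s / N%:R).
  have /andP[y0 ys] := xa i; set y := x 0 i - _ in y0 ys *.
  have /truncn_itv/andP[t1 t2] : 0 <= y / (s / N%:R) by rewrite divr_ge0// ltW.
  rewrite ler_pdivlMr// in t1; rewrite ltr_pdivrMr// in t2.
  have [tN|Nt] := ltnP (Num.truncn (y / (s / N%:R))) N.
    by exists (Ordinal tN); rewrite t1 ltW.
  have N1 : (N.-1 < N)%N by rewrite prednK.
  exists (Ordinal N1) => /=; rewrite prednK//; apply/andP; split.
    apply: le_trans t1; rewrite ler_pM2r// ler_nat.
    by rewrite (leq_trans _ Nt)// leq_pred.
  by rewrite mulrCA divff ?mulr1// gt_eqF.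
have [f fP] := choice fex.
exists [ffun i => f i]; apply/cubeP => i; rewrite mxE ffunE.
have /andP[f1 f2] := fP i; rewrite -natr1 mulrDl mul1r in f2.
by apply/andP; split; lra.
Qed.

Lemma cube_edist a s x y : 0 <= s -> cube a s x -> cube a s y ->
  edist x y <= d%:R * s.
Proof.
move=> s0 /cubeP xa /cubeP ya; rewrite (le_trans (enorm_le_norm _))// ler_wpM2l//.
rewrite -[`|_|]/(mx_norm _) mx_normrE; apply/bigmax_leP; split=> // -[j i] _ /=.
rewrite (ord1 j) !mxE ler_norml.
by have := xa i; have := ya i => /andP[? ?] /andP[? ?]; apply/andP; split; lra.
Qed.

(** The cubes are given by their lowest corners and have a common side. *)
Definition cube_cover E (L : seq 'rV[R]_d) s :=
  forall x, E x -> exists2 a, a \in L & cube a s x.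

Definition porous E (N : nat) s := forall a, exists f : {ffun 'I_d -> 'I_N},
  forall x, E x -> ~ cube (subcube N a s f) (s / N%:R) x.

(** Each cube is replaced by its subcubes except the one that misses E. *)
Lemma porous_refine E (N : nat) s L : (0 < N)%N -> 0 < s -> porous E N s ->
  cube_cover E L s ->
  exists2 L', size L' = (size L * (N ^ d).-1)%N & cube_cover E L' (s / N%:R).
Proof.
move=> N0 s0 pE; elim: L E pE => [|a L IH] E pE EL.
  by exists [::] => // x /EL[].
have [L' szL' EL'] : exists2 L', size L' = (size L * (N ^ d).-1)%N &
    cube_cover (E `\` cube a s) L' (s / N%:R).
  apply: IH => [b|x [/EL[b]]].
    by have [f fE] := pE b; exists f => x [/fE].
  by rewrite inE => /predU1P[-> //|bL bx _]; exists b.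
have [f fE] := pE a.
exists ([seq subcube N a s g | g <- rem f (enum {ffun 'I_d -> 'I_N})] ++ L').
  rewrite size_cat size_map size_rem ?mem_enum// -cardE card_ffun !card_ord szL'.
  by rewrite mulSn.
move=> x Ex; have [ax|nax] := pselect (cube a s x); last first.
  by have [b bL' bx] := EL' x (conj Ex nax); exists b => //;
    rewrite mem_cat bL' orbT.
have [g gx] := subcube_cover N a s x N0 s0 ax.
exists (subcube N a s g) => //; rewrite mem_cat; apply/orP; left; apply: map_f.
rewrite mem_rem_uniq ?enum_uniq// !inE mem_enum andbT.
by apply/eqP => gf; apply: (fE x Ex); rewrite -gf.
Qed.

Lemma porous_iter E (N : nat) s L k : (0 < N)%N -> 0 < s ->
  (forall s', 0 < s' <= s -> porous E N s') -> cube_cover E L s ->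
  exists2 L', size L' = (size L * (N ^ d).-1 ^ k)%N &
    cube_cover E L' (s / N%:R ^+ k).
Proof.
move=> N0 s0 pE EL; have N0' : 0 < N%:R :> R by rewrite ltr0n.
elim: k => [|k [L' szL' EL']]; first by exists L;
  rewrite ?expn0 ?muln1// expr0 divr1.
have sk0 : 0 < s / N%:R ^+ k by rewrite divr_gt0// exprn_gt0.
have [|L'' szL'' EL''] := porous_refine E N (s / N%:R ^+ k) L' N0 sk0 _ EL'.
  apply: pE; rewrite sk0 ler_pdivrMr ?exprn_gt0// ler_peMr ?(ltW s0)//.
  by rewrite exprn_ege1// ler1n.
exists L''; first by rewrite szL'' szL' expnSr mulnA.
by rewrite exprSr invfM mulrA.
Qed.

Lemma lebesgue_ge0 (E : set (borel R d)) : (0 <= lebesgue E)%E.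
Proof.
apply: le_ereal_inf_tmp => _ [b [bv _] <-]; apply: nneseries_ge0 => k _ _.
by rewrite lee_fin prodr_ge0// => i _; rewrite subr_ge0.
Qed.

(** A finite cover is turned into a sequence by adding degenerate boxes, whose
volume is 0 because the dimension is positive. *)
Lemma lebesgue_cube_cover E (L : seq 'rV[R]_d) s : (0 < d)%N -> 0 <= s ->
  cube_cover E L s ->
  (lebesgue (E : set (borel R d)) <= ((size L)%:R * s ^+ d)%:E)%E.
Proof.
move=> d0 s0 EL.
pose b k := if (k < size L)%N then (nth 0 L k, nth 0 L k + const_mx s) else (0, 0).
have vol k : box_volume (b k).1 (b k).2 = if (k < size L)%N then s ^+ d else 0.
  rewrite /b /box_volume; case: ifP => _ /=.
    rewrite (eq_bigr (fun=> s)) ?prodr_const ?card_ord// => i _.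
    by rewrite !mxE addrAC subrr add0r.
  by rewrite (eq_bigr (fun=> 0)) ?prodr_const ?card_ord ?expr0n ?gtn_eqF// =>
    i _; rewrite subrr.
have -> : ((size L)%:R * s ^+ d)%:E =
  (\sum_(k <oo) (box_volume (b k).1 (b k).2)%:E)%E.
  rewrite (@nneseries_split _ _ 0 (size L)); last first.
    by move=> k _; rewrite vol lee_fin; case: ifP => // _; exact: exprn_ge0.
  rewrite add0n [X in (_ + X)%E]eseries0 ?adde0; last first.
    by move=> k Lk _; rewrite vol ltnNge Lk.
  rewrite big_mkord (eq_bigr (fun=> (s ^+ d)%:E)).
    by rewrite sumEFin sumr_const card_ord mulr_natl.
  by move=> k _; rewrite vol ltn_ord.
apply: ereal_inf_lbound; exists b => //; split=> [k i|x Ex].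
  by rewrite /b; case: ifP => _ //=; rewrite !mxE lerDl.
have [a aL ax] := EL x Ex; exists (index a L) => //.
by rewrite /b index_mem aL nth_index.
Qed.

(** A cube containing E is first cut into cubes of side at most s; then k
refinements multiply the total volume by ((N^d - 1) / N^d)^k. *)
Lemma porous_null E (N : nat) s a S : (0 < d)%N -> (0 < N)%N -> 0 < s ->
  (forall s', 0 < s' <= s -> porous E N s') -> E `<=` cube a S ->
  lebesgue (E : set (borel R d)) = 0%E.
Proof.
move=> d0 N0 s0 pE ES; have N0' : 0 < N%:R :> R by rewrite ltr0n.
pose S' := Num.max S s.
have S'0 : 0 < S' by rewrite lt_max s0 orbT.
have ES' : E `<=` cube a S'.
  move=> x /ES/cubeP xa; apply/cubeP => i; have /andP[-> xS] := xa i.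
  by rewrite le_max xS.
pose M := (Num.truncn (S' / s)).+1.
have M0 : (0 < M)%N by [].
have M0' : 0 < M%:R :> R by rewrite ltr0n.
pose s1 := S' / M%:R.
have s10 : 0 < s1 by rewrite divr_gt0.
have s1s : s1 <= s.
  rewrite ler_pdivrMr// mulrC -ler_pdivrMr//.
  have /truncn_itv/andP[_] : 0 <= S' / s by rewrite divr_ge0// ltW.
  exact: ltW.
pose L := [seq subcube M a S' g | g <- enum {ffun 'I_d -> 'I_M}].
have EL : cube_cover E L s1.
  move=> x /ES' ax; have [g gx] := subcube_cover M a S' x M0 S'0 ax.
  by exists (subcube M a S' g) => //; apply: map_f; rewrite mem_enum.
have pE' s' : 0 < s' <= s1 -> porous E N s'.
  by move=> /andP[s'0 s's]; apply: pE; rewrite s'0 (le_trans s's).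
pose q : R := (N ^ d).-1%:R / N%:R ^+ d.
have Nd : (0 < N ^ d)%N by rewrite expn_gt0 N0.
have q01 : `|q| < 1.
  rewrite ger0_norm ?divr_ge0 ?exprn_ge0// ltr_pdivrMr ?exprn_gt0// mul1r -natrX.
  by rewrite ltr_nat prednK.
have le_k k : (lebesgue (E : set (borel R d)) <=
  ((size L)%:R * s1 ^+ d * q ^+ k)%:E)%E.
  have [L' szL' EL'] := porous_iter E N s1 L k N0 s10 pE' EL.
  apply: le_trans (lebesgue_cube_cover _ _ _ d0 _ EL') _.
    by rewrite divr_ge0 ?exprn_ge0// ltW.
  rewrite lee_fin szL' natrM natrX /q !expr_div_n -!exprM (mulnC k d).
  by rewrite le_eqVlt; apply/orP; left; apply/eqP; ring.
apply/eqP; rewrite eq_le lebesgue_ge0 andbT; apply/lee_addgt0Pr => e e0.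
rewrite add0e.
have : (size L)%:R * s1 ^+ d * q ^+ k @[k --> \oo] --> (size L)%:R * s1 ^+ d * 0.
  by apply: cvgM; [exact: cvg_cst|exact: cvg_expr].
rewrite mulr0 => /cvgrPdist_lt/(_ e e0)[k _ /(_ k (leqnn k))] /=.
rewrite sub0r normrN => ke; apply: (le_trans (le_k k)).
by rewrite lee_fin (le_trans (ler_norm _))// ltW.
Qed.

(** If a boundary point x lies in the middle subcube, then x is at distance at
least s / 3 from the faces of the cube. The hole of radius s / 4 next to x
therefore has its centre in the cube, and it contains the subcube of its
centre, whose diameter is at most d s / N < s / 4. *)
Lemma boundary_porous A (r : R) s : (0 < d)%N -> closed A -> prox_regular A r ->
  0 < s <= r -> porous (boundary A) (8 * d).+1 s.
Proof.
move=> d0 cA pA /andP[s0 sr] a.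
set N := (8 * d).+1.
have m_lt : (4 * d < N)%N by rewrite ltnS leq_mul2r orbT.
pose m : {ffun 'I_d -> 'I_N} := [ffun=> Ordinal m_lt].
have [empty|] := pselect (forall x, boundary A x ->
  ~ cube (subcube N a s m) (s / N%:R) x).
  by exists m.
move=> /existsNP[x /not_implyP[bx /contrapT/cubeP mx]].
have s4 : 0 < s / 4 < r.
  by apply/andP; split; [rewrite divr_gt0|rewrite ltr_pdivrMr//; lra].
have s12 : 0 < s / 12 by rewrite divr_gt0.
have [c cx cA'] := boundary_hole _ _ _ _ _ cA pA s4 s12 bx.
have d1 : 1 <= d%:R :> R by rewrite ler1n.
have NE : N%:R = 8 * d%:R + 1 :> R by rewrite /N -natr1 natrM.
have N0 : 0 < N%:R :> R by rewrite ltr0n.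
have sN : s = N%:R * (s / N%:R) by rewrite mulrCA divff ?mulr1// gt_eqF.
have sN0 : 0 < s / N%:R by rewrite divr_gt0.
have ac : cube a s c.
  apply/cubeP => i; have := mx i; rewrite mxE ffunE /=.
  have := le_lt_trans (coord_le_enorm (c - x) i) cx.
  rewrite !mxE ltr_norml natrM => /andP[c1 c2] /andP[m1 m2].
  set k := s / N%:R in sN sN0 m1 m2.
  have kd : k <= d%:R * k by rewrite ler_peMl// ltW.
  have sE : s = 8 * (d%:R * k) + k by rewrite sN NE; ring.
  have m1' : 4 * (d%:R * k) <= x 0 i - a 0 i by lra.
  have m2' : x 0 i - a 0 i <= 4 * (d%:R * k) + k by lra.
  by apply/andP; split; lra.
have [f fc] := subcube_cover N a s c isT s0 ac.
exists f => x' /(boundary_sub _ cA) Ax' fx'.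
have := cA' _ Ax'; have := cube_edist _ _ _ _ (ltW sN0) fc fx'.
move: sN sN0; set k := s / N%:R => sN k0.
have sE : s = 8 * (d%:R * k) + k by rewrite sN NE; ring.
by lra.
Qed.

(** Stated for all subsets of the boundary, which is what absolute continuity
asks for. *)
Lemma boundary_null K A (r : R) : (0 < d)%N -> compact K -> A `<=` K -> closed A ->
    0 < r -> prox_regular A r ->
  forall B : set (borel R d), B `<=` boundary A -> lebesgue B = 0%E.
Proof.
move=> d0 cK AK cA r0 pA B BA.
have [M [_ KM]] : bounded_set K := compact_bounded cK.
have KM1 x : K x -> `|x| <= `|M| + 1.
  by move=> Kx; apply: KM => //; rewrite (le_lt_trans (ler_norm _))// ltrDl.
apply: (@porous_null _ (8 * d).+1 r (const_mx (- (`|M| + 1)))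
  (2 * (`|M| + 1))) => //.
  move=> s sr a; have [f fA] := boundary_porous A r s d0 cA pA sr a.
  by exists f => x /BA; exact: fA.
move=> x /BA/(boundary_sub _ cA)/AK/KM1 xM; apply/cubeP => i.
have : `|x 0 i| <= `|M| + 1.
  apply: le_trans xM; rewrite -[leRHS]/(mx_norm x) mx_normrE.
  by rewrite (le_bigmax _ (fun ij => `|x ij.1 ij.2|) (0, i)).
by rewrite mxE ler_norml => /andP[? ?]; apply/andP; split; lra.
Qed.

End porosity.

(** * Null levels and symmetric differences *)

Section borel_probability.
Context {R : realType} {d : nat}.
Implicit Types (a x y z p q : 'rV[R]_d) (A B E : set 'rV[R]_d) (s e eta : R).
Implicit Types (P Q : probability (borel R d) R).

Lemma closed_measurable_borel A : closed A -> measurable (A : set (borel R d)).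
Proof.
move=> cA; rewrite -[X in measurable X](setCK A); apply: measurableC.
by apply: sub_sigma_algebra; exact: closed_openC.
Qed.

Lemma continuous_measurable_borel (f : 'rV[R]_d -> R) : continuous f ->
  measurable_fun [set: borel R d] (f : borel R d -> R).
Proof.
move=> cf; apply: (measurability _ (measurable_realfun.RGenOpens.measurableE R)).
move=> _ [_ [a [b ->] <-]]; rewrite setTI; apply: sub_sigma_algebra.
by apply: open_comp => [x _|]; [exact: cf|exact: interval_open].
Qed.

(** The level sets are disjoint, so only countably many of them have positive
probability, and an interval is uncountable. *)
Lemma null_level P (f : 'rV[R]_d -> R) s : continuous f -> 0 < s ->
  exists2 eta, 0 < eta < s & P [set x | f x = eta] = 0%E.
Proof.
move=> cf s0; pose X : {RV P >-> R} :=
  mfun_Sub (mem_set (continuous_measurable_borel f cf)).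
have := @pmf_gt0_countable _ _ _ P X.
set C := [set _ | _] => cC; apply: contrapT => noeta.
have : `]0, s[%classic `<=` C.
  move=> t; rewrite /= in_itv/= => ts; rewrite /C/= lt0r pmf_ge0 andbT.
  apply/eqP => Xt; apply: noeta; exists t => //.
  rewrite -[LHS]fineK; first by rewrite -[RHS]/(0%:E) -Xt.
  rewrite fin_num_measure//; apply: closed_measurable_borel.
  by apply: (@preimage_closed _ _ f [set u | u = t]) => [x _|];
    [exact: cf|exact: closed_eq].
move=> /subset_card_le/sub_countable/(_ cC)/countable_lebesgue_measure0.
by rewrite lebesgue_measure_itv/= lte_fin s0 oppr0 adde0 => -[] s00;
  rewrite s00 ltxx in s0.
Qed.

Lemma thickening_closed A eta : A !=set0 -> closed (thickening A eta).
Proof.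
move=> A0; apply: (@preimage_closed _ _ (edist_set ^~ A) [set t | t <= eta]).
  by move=> y _; exact: edist_set_continuous.
exact: closed_le.
Qed.

Lemma boundary_thickening A eta : A !=set0 ->
  boundary (thickening A eta) `<=` [set x | edist_set x A = eta].
Proof.
move=> A0 x /(boundaryP _ _ (thickening_closed A eta A0))[xA nxA] /=.
apply/eqP; rewrite eq_le [_ <= _]xA/=; apply/ler_addgt0Pl => e e0.
have [y /negP + xy] := nxA e e0; rewrite -ltNge => yA.
rewrite (le_trans (ltW yA))// (le_trans (edist_set_lipschitz y x A A0))//.
by rewrite addrC lerD2r edistC ltW.
Qed.

(** A point of one set outside the other has its nearest point in the other
set on the boundary of that set. *)
Lemma boundary_diff A B eta : compact A -> A !=set0 -> compact B -> B !=set0 ->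
    0 < eta ->
    (forall x, A x -> exists2 y, B y & edist x y < eta / 2) ->
    (forall x, B x -> exists2 y, A y & edist x y < eta / 2) ->
    (forall x, boundary A x -> exists2 y, boundary B y & edist x y < eta / 2) ->
  (A `<=` B `|` thickening (boundary B) eta) /\
  (B `<=` A `|` thickening (boundary B) eta).
Proof.
move=> cA A0 cB B0 eta0 AB BA bAB; split=> x Xx.
- have [Bx|nBx] := pselect (B x); first by left.
  right; have [p xp] := projection_exists B x cB B0.
  have bp := projection_boundary _ _ _ (compact_closed_rV _ cB) nBx xp.
  have [y By xy] := AB x Xx; have := (proj2 xp) y By; have := edist_set_le x bp.
  by rewrite /thickening/=; lra.
- have [Ax|nAx] := pselect (A x); first by left.
  right; have [p xp] := projection_exists A x cA A0.
  have bp := projection_boundary _ _ _ (compact_closed_rV _ cA) nAx xp.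
  have [q bq pq] := bAB p bp.
  have [y Ay xy] := BA x Xx; have := (proj2 xp) y Ay; have := edist_set_le x bq.
  by have := edist_triangle p x q; rewrite /thickening/=; lra.
Qed.

Lemma probability_dist_le Q A B E : closed A -> closed B -> closed E ->
  A `<=` B `|` E -> B `<=` A `|` E -> `|fine (Q A) - fine (Q B)| <= fine (Q E).
Proof.
move=> /closed_measurable_borel mA /closed_measurable_borel mB
  /closed_measurable_borel mE.
have key (A' B' : set (borel R d)) : measurable A' -> measurable B' ->
    A' `<=` B' `|` E -> fine (Q A') <= fine (Q B') + fine (Q E).
  move=> mA' mB' AB; rewrite -lee_fin EFinD !fineK ?fin_num_measure//.
  apply: le_trans (measureU2 _ mB' mE).
  by rewrite le_measure ?inE//; exact: measurableU.
move=> AB BA; have := key _ _ mA mB AB; have := key _ _ mB mA BA.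
by rewrite ler_norml => *; apply/andP; split; lra.
Qed.

(** The thickenings of the closed null set E decrease to E, and the boundary
of a thickening lies on a level set of the distance to E, which is null for
some arbitrarily small thickness. *)
Lemma small_null_thickening P E e : closed E -> E !=set0 -> P E = 0%E -> 0 < e ->
  exists eta : R, [/\ 0 < eta, fine (P (thickening E eta)) < e &
    P (boundary (thickening E eta)) = 0%E].
Proof.
move=> cE E0 PE e0.
pose T n : set (borel R d) := thickening E n.+1%:R^-1.
have mT eta : measurable (thickening E eta : set (borel R d)).
  by apply: closed_measurable_borel; exact: thickening_closed.
have TE : \bigcap_n T n = E.
  apply/seteqP; split=> x.
    move=> xT; apply: closed_edist_set0 => // s s0.
    have [n ns] := ltr_add_invr s0; rewrite add0r in ns.
    by rewrite (le_trans (xT n I))// ltW.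
  move=> Ex n _; rewrite /T /thickening/= (le_trans (edist_set_le x Ex))//.
  by rewrite edistxx.
have : P \o T @ \oo --> P (\bigcap_n T n).
  apply: nonincreasing_cvg_mu.
  - by rewrite -ge0_fin_numE// fin_num_measure//; exact: mT.
  - by move=> n; exact: mT.
  - by rewrite TE; exact: closed_measurable_borel.
  - move=> m n mn; apply/subsetPset => x; rewrite /T /thickening/= => /le_trans.
    by apply; rewrite lef_pV2 ?posrE// ler_nat.
rewrite TE PE => /fine_cvg/cvgrPdist_lt/(_ e e0)[n _ /(_ n (leqnn n))] /=.
rewrite sub0r normrN ger0_norm ?fine_ge0// => PTn.
have n0 : 0 < n.+1%:R^-1 :> R by rewrite invr_gt0.
have [eta /andP[eta0 etan] Peta] := null_level P _ _ (edist_set_continuous E E0) n0.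
exists eta; split=> //.
  have sub : thickening E eta `<=` T n.
    by move=> x; rewrite /T /thickening/= => /le_trans; apply; exact: ltW.
  apply: le_lt_trans PTn.
  by apply: fine_le; rewrite ?fin_num_measure ?le_measure ?inE//; exact: mT.
apply/eqP; rewrite eq_le measure_ge0 andbT -Peta; apply: le_measure; rewrite ?inE.
- by apply: closed_measurable_borel; exact: closed_boundary.
- apply: closed_measurable_borel.
  apply: (@preimage_closed _ _ (edist_set ^~ E) [set u | u = eta]);
    last exact: closed_eq.
  by move=> x _; exact: edist_set_continuous.
- exact: boundary_thickening.
Qed.

End borel_probability.

(** * Uniformity of weak convergence over the class *)

Section uniformity.
Context {R : realType} {d : nat} (d_gt0 : (0 < d)%N).
Context (K : set 'rV[R]_d) (cK : compact K) (r : R) (r0 : 0 < r).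
Implicit Types (a x y z p q : 'rV[R]_d) (A B E : set 'rV[R]_d) (s e eta : R).
Implicit Types (P Q : probability (borel R d) R).

Lemma boundary_class_null P A : P `<< @lebesgue R d -> reach_class K r A ->
  P (boundary A) = 0%E.
Proof.
move=> Pac /(reach_classP _ cK _ r0)[AK A0 cA pA].
apply: (Pac (boundary A)) => //.
  by move=> B _; exact: (boundary_null K A r).
by apply: closed_measurable_borel; exact: closed_boundary.
Qed.

(** If it fails, there are bad sets G n of the class for infinitely many n;
they have a limit L along an ultrafilter, and G n differs from L only inside
a thickening T of the boundary of L, so that
|P_n(G n) - P(G n)| <= P_n(T) + |P_n(L) - P(L)| + P(T). *)
Lemma uniform_weak_convergence P (P_ : nat -> probability (borel R d) R) e :
    P `<< @lebesgue R d -> weakly_converges P_ P -> 0 < e ->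
  \forall n \near \oo, forall A, reach_class K r A ->
    `|fine (P_ n A) - fine (P A)| <= e.
Proof.
move=> Pac PnP e0; apply: contrapT => nfreq.
pose bad := [set n | exists A,
  reach_class K r A /\ e < `|fine (P_ n A) - fine (P A)|].
have FF : ProperFilter (within bad \oo).
  apply: Build_ProperFilter => -[N _ NF]; apply: nfreq; exists N => // n Nn A KA.
  by rewrite leNgt; apply/negP => nA; apply: (NF n Nn); exists A.
have [F [FU FF']] := ultraFilterLemma FF.
have Foo S : (\oo : set_system nat) S -> F S.
  by move=> ooS; apply: FF'; apply: filterS ooS => n.
pose G n := xget set0 [set A |
  reach_class K r A /\ e < `|fine (P_ n A) - fine (P A)|].
have FG : F [set n | reach_class K r (G n) /\
  e < `|fine (P_ n (G n)) - fine (P (G n))|].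
  apply: FF'; apply: (@filterE _ \oo) => n badn.
  exact: (xgetPex set0 (P :=
    [set A | reach_class K r A /\ e < `|fine (P_ n A) - fine (P A)|])).
have FG' : F [set n | [/\ G n `<=` K, G n !=set0,
  closed (G n) & prox_regular (G n) r]].
  by apply: filterS FG => n [/(reach_classP _ cK _ r0)].
pose L := set_limit F G.
have KL : reach_class K r L.
  apply/(reach_classP _ cK _ r0); split.
  - exact: set_limit_sub FG'.
  - exact: set_limit_nonempty FG'.
  - exact: closed_set_limit.
  - exact: set_limit_prox_regular FG'.
have cL := reach_class_compact K cK r L KL.
have [_ L0 clL _] := KL.
have PbL := boundary_class_null P L Pac KL.
have e4 : 0 < e / 4 by rewrite divr_gt0.
have [eta [eta0 Peta Pbeta]] := small_null_thickening P (boundary L) _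
  (closed_boundary L) (boundary_nonempty d_gt0 L cL L0) PbL e4.
set T := thickening (boundary L) eta in Peta Pbeta.
have clT : closed T by exact/thickening_closed/boundary_nonempty.
have near_cvg B : closed B -> P (boundary B) = 0%E ->
    F [set n | `|fine (P_ n B) - fine (P B)| < e / 4].
  move=> /closed_measurable_borel mB PbB; apply: Foo.
  have := PnP B mB PbB; rewrite -{1}(fineK (fin_num_measure P _ mB)) => /fine_cvg.
  by move/cvgrPdist_lt/(_ _ e4); apply: filterS => n /=; rewrite distrC.
have eta2 : 0 < eta / 2 by rewrite divr_gt0.
have h1 := set_limit_near_sub _ _ cK _ _ FG' _ eta2.
have h2 := set_limit_near_sup _ _ cK _ _ FG' _ eta2.
have h3 := boundary_set_limit_near_sup _ _ cK _ r0 _ FG' _ eta2.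
have [n [[[KG bad_n] [PT PL]] [h1n [h2n h3n]]]] := filter_ex
  (filterI (filterI FG (filterI (near_cvg T clT Pbeta) (near_cvg L clL PbL)))
    (filterI (h1 FU) (filterI (h2 FU) (h3 FU)))).
have cG := reach_class_compact K cK r _ KG.
have [_ G0 clG _] := KG.
have [GL LG] := boundary_diff (G n) L eta cG G0 cL L0 eta0 h2n h1n h3n.
have d1 := probability_dist_le (P_ n) _ _ _ clG clL clT GL LG.
have d2 := probability_dist_le P _ _ _ clG clL clT GL LG.
move: PT PL bad_n => /=; rewrite ltNge => PT PL /negP; apply.
have t1 := ler_distD (fine (P_ n L)) (fine (P_ n (G n))) (fine (P (G n))).
have t2 := ler_distD (fine (P L)) (fine (P_ n L)) (fine (P (G n))).
rewrite (distrC (fine (P L))) in t2.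
have := ler_norm (fine (P_ n T) - fine (P T)).
rewrite -/T in d1 d2; lra.
Qed.

End uniformity.

Theorem theorem5 (R : realType) (d : nat) (d_gt0 : (0 < d)%N)
    (K : set 'rV[R]_d) (K_compact : compact K) (K_nonempty : K !=set0)
    (r : R) (r_gt0 : 0 < r) :
  (forall A, reach_class K r A ->
     exists X : hyperspace R d, hset X = boundary A) /\
  compact [set X : hyperspace R d | (boundary @` reach_class K r) (hset X)] /\
  forall P : probability (borel R d) R, P `<< @lebesgue R d ->
    uniformity_class (reach_class K r) P.
Proof.
split; [|split].
- move=> A KA; have [_ A0 _ _] := KA.
  by apply: boundary_hyperspace => //; exact: reach_class_compact KA.
- exact: compact_boundary_class.
move=> P Pac; split=> [A [_ _ cA _]|P_ PnP]; first exact: closed_measurable_borel.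
apply/cvgrPdist_le => e e0.
apply: filterS (uniform_weak_convergence d_gt0 K K_compact r r_gt0 P P_ e Pac
  PnP e0).
move=> n Pn; rewrite sub0r normrN.
set S := [set _ | _ in _].
have [->|/set0P S0] := eqVneq S set0; first by rewrite sup0 normr0 ltW.
have Se : ubound S e by move=> _ [A KA <-]; exact: Pn.
rewrite ger0_norm; first exact: ge_sup.
have [x Sx] := S0; apply: le_trans (ub_le_sup _ Sx); last by exists e.
by have [A _ <-] := Sx.
Qed.
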